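(* Assume the standing hypotheses below (in particular, that homogeneous $f,g\in\mathfrak p$ with $\sqrt{(f,g)R}=\mathfrak p$ exist). Then every minimal prime divisor of the ideal $(f_{\min},g_{\min})R$ and every minimal prime divisor of the ideal $(f_{\max},g_{\max})R$ has height one. In particular, $f_{\min},g_{\min}$ have a non-unit common divisor in $R$, and $f_{\max},g_{\max}$ have a non-unit common divisor in $R$.
   Context: Let $k$ be an algebraically closed field of characteristic zero, $R=k[w,x,y,z]$, and let $\mathfrak p\subseteq R$ be the homogeneous prime ideal of Macaulay's curve $C_4\subseteq\mathbb P^3_k$, the curve with parametrization $[s^4:s^3t:st^3:t^4]$. Endow $R$ with the bigrading $\deg w=(4,0)$, $\deg x=(3,1)$, $\deg y=(1,3)$, $\deg z=(0,4)$; $\mathfrak p$ is bihomogeneous. Standing hypothesis: $f,g\in\mathfrak p$ are homogeneous (in the usual grading) of degrees $d_1,d_2$ with $\sqrt{(f,g)R}=\mathfrak p$. Write $f=\sum_{i=i_{\min}}^{i_{\max}} f^{(i,4d_1-i)}$ and $g=\sum_{j=j_{\min}}^{j_{\max}} g^{(j,4d_2-j)}$ as sums of bihomogeneous components, where $f^{(i,4d_1-i)}$ is the component of bidegree $(i,4d_1-i)$ and $i_{\min},i_{\max},j_{\min},j_{\max}$ are chosen so that $f_{\min}:=f^{(i_{\min},4d_1-i_{\min})}$, $f_{\max}:=f^{(i_{\max},4d_1-i_{\max})}$, $g_{\min}:=g^{(j_{\min},4d_2-j_{\min})}$, $g_{\max}:=g^{(j_{\max},4d_2-j_{\max})}$ are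 all nonzero. *)

(* Defs.v *)
From HB Require Import structures.
From mathcomp Require Import all_boot all_order all_algebra.
Set Implicit Arguments. Unset Strict Implicit. Unset Printing Implicit Defensive.
Import GRing.Theory.
Local Open Scope ring_scope.

Section Ideals.
Variable R : comNzRingType.

Definition subI (I J : R -> Prop) : Prop := forall h, I h -> J h.
Definition ssubI (I J : R -> Prop) : Prop := subI I J /\ exists h, J h /\ ~ I h.
Definition eqI (I J : R -> Prop) : Prop := forall h, I h <-> J h.

Definition ideal2 (f g : R) : R -> Prop := fun h => exists a b, h = a * f + b * g.

Definition radical (I : R -> Prop) : R -> Prop := fun h => exists n : nat, I (h ^+ n).

Definition prime_ideal (P : R -> Prop) : Prop :=
  [/\ P 0, (forall a b, P a -> P b -> P (a + b)),
      (forall r a, P a -> P (r * a)), ~ P 1 &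
      (forall a b, P (a * b) -> P a \/ P b)].

Definition minimal_prime_over (I P : R -> Prop) : Prop :=
  [/\ prime_ideal P, subI I P &
      forall Q, prime_ideal Q -> subI I Q -> subI Q P -> subI P Q].

Definition prime_chain_below (P : R -> Prop) (n : nat) : Prop :=
  exists Q : nat -> R -> Prop,
    [/\ forall m, (m <= n)%N -> prime_ideal (Q m),
        forall m, (m < n)%N -> ssubI (Q m) (Q m.+1) &
        eqI (Q n) P].

Definition height_eq (P : R -> Prop) (n : nat) : Prop :=
  [/\ prime_ideal P, prime_chain_below P n & ~ prime_chain_below P n.+1].

Definition divides (h f : R) : Prop := exists q, f = q * h.

End Ideals.

(* An element F : R4 k is read as a polynomial in z (outermost) with
   coefficients in k[y] ... k[w] (innermost); the coefficient of
   w^a x^b y^c z^d is  F`_d`_c`_b`_a. *)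
Definition R4 (k : fieldType) := {poly {poly {poly {poly k}}}}.

Section Macaulay.
Variable k : fieldType.

Definition coef4 (F : R4 k) (a b c d : nat) : k := F`_d`_c`_b`_a.

Definition homogeneous (dd : nat) (F : R4 k) : Prop :=
  forall a b c d, coef4 F a b c d != 0 -> (a + b + c + d)%N = dd.

(* bidegree of w^a x^b y^c z^d with deg w=(4,0), x=(3,1), y=(1,3), z=(0,4) *)
Definition bideg1 (a b c d : nat) : nat := (4 * a + 3 * b + c)%N.
Definition bideg2 (a b c d : nat) : nat := (b + 3 * c + 4 * d)%N.

Definition bicomp (i j : nat) (F : R4 k) : R4 k :=
  \poly_(d < size F) \poly_(c < size F`_d) \poly_(b < size F`_d`_c)
    \poly_(a < size F`_d`_c`_b)
      (if (bideg1 a b c d == i) && (bideg2 a b c d == j) then F`_d`_c`_b`_a else 0).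

(* evaluation at the parametrization [s^4 : s^3 t : s t^3 : t^4] in k[s,t] *)
Definition S2 := {poly {poly k}}.
Definition var_s : S2 := ('X : {poly k})%:P.
Definition var_t : S2 := 'X.
Definition ev0 (c : k) : S2 := c%:P%:P.
Definition ev1 (q : {poly k}) : S2 := (map_poly ev0 q).[var_s ^+ 4].
Definition ev2 (q : {poly {poly k}}) : S2 := (map_poly ev1 q).[var_s ^+ 3 * var_t].
Definition ev3 (q : {poly {poly {poly k}}}) : S2 := (map_poly ev2 q).[var_s * var_t ^+ 3].
Definition ev4 (q : R4 k) : S2 := (map_poly ev3 q).[var_t ^+ 4].

Definition macaulay_ideal : R4 k -> Prop := fun F => ev4 F = 0.

End Macaulay.

(* Main.v *)
Require Import Defs.
From HB Require Import structures.
From mathcomp Require Import all_boot all_order all_algebra.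
From mathcomp Require Import zify ring.
From Stdlib Require Import Classical.
Set Implicit Arguments. Unset Strict Implicit. Unset Printing Implicit Defensive.
Import GRing.Theory.
Local Open Scope ring_scope.

(**
Let a torus act with one of the two degrees as weight: it degenerates (f, g) to
the pair (f0, g0) of initial forms, through a family (F, G) over k[T]. Write
f0 = h f', g0 = h g' with f', g' coprime. A prime P that contains f', g' but not
h contains the Macaulay ideal p, because T is a nonzerodivisor modulo (F, G) up
to powers of h. So if a minimal prime of (f0, g0) did not contain h, or if h
were a unit, then h would lie outside p; if instead the minimal prime contains
h, it is generated by a prime factor of h and has height one.

Assume that h is not in p. Put w = z = 1. The fibres of the family over T <> 0
have d1 d2 points by Bezout, all on the curve, and the limit at T = 0 is a
quotient of k[x, y] / (f', g'), since h is a unit near the curve. By Bezout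
d1 d2 <= (d1 - e) (d2 - e) with e = deg h, so h is constant and f0, g0 cut
out the curve set-theoretically. Restricting to w = z = 0 shows, up to
exchanging f0 and g0, that f0 = x^d1 + ... and g0 = y^d2 + ..., so that the
monomials x^i y^j (i < d1, j < d2) are a basis of k[x, y] / (f0, g0). Rewriting
with f0 lowers the first degree by at least 8 and rewriting with g0 lowers the
second degree by at least 8, whereas passing from x y m to m lowers both by 4;
hence multiplication by x y has trace 0. But x y - 1 is nilpotent, so this
trace is d1 d2, which is nonzero in characteristic zero.
*)

(** * Unique factorization *)

(** Putting w = z = 1 restricts to the plane w = z, whose line at infinity is w = z = 0. The curve
    meets this plane in the four points x^4 = 1, y = x^3 and misses the line, since w and z vanish
    together only for s = t = 0; so no intersection point of a fibre over T <> 0 escapes to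
    infinity. At the four points a bihomogeneous form takes the value c x^j with a single constant
    c, which vanishes only for elements of p; this is why h is invertible near them.

    Coprime forms in four variables may acquire a common factor on the plane. Such a factor divides
    a power of the restriction of h, so it can be cancelled in the limit, and the upper Bezout bound
    survives.

    The number 8 reflects the absent monomial s^2 t^2. Replacing x^2 by w times s^2 t^2 would lower
    the first degree in x and y by only 4, but s^2 t^2 is not a coordinate, so w occurs at least
    twice in every other term of the form containing x^d1; likewise for z and y^d2. *)

Section Divisibility.
Variable A : idomainType.
Implicit Types a b p q : A.

Definition prime_elt p :=
  [/\ p != 0, p \isn't a GRing.unit &
      forall a b, divides p (a * b) -> divides p a \/ divides p b].

Definition factors_as a (s : seq A) :=
  (forall p, p \in s -> prime_elt p) /\
  exists2 u, u \is a GRing.unit & a = u * \prod_(p <- s) p.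

(** Factorization is into prime rather than irreducible elements; uniqueness is then automatic. *)
Definition ufd := forall a, a != 0 -> exists s, factors_as a s.

(** Every syzygy of the pair is a Koszul syzygy. This is the form in which coprimality is used: in
    top forms, in Macaulay matrices and in the saturation by T. *)
Definition rel_prime p q := forall a b, a * p = b * q -> divides q a.

Lemma divides_mull p a b : divides p b -> divides p (a * b).
Proof. by case=> q ->; exists (a * q); rewrite mulrA. Qed.

Lemma divides_mulr p a b : divides p a -> divides p (a * b).
Proof. by rewrite mulrC; apply: divides_mull. Qed.

Lemma dividesD p a b : divides p a -> divides p b -> divides p (a + b).
Proof. by case=> x -> [y ->]; exists (x + y); rewrite mulrDl. Qed.

Lemma dividesB p a b : divides p a -> divides p b -> divides p (a - b).
Proof. by case=> x -> [y ->]; exists (x - y); rewrite mulrBl. Qed.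

Lemma prime_elt_ndivides_unit p u : prime_elt p -> u \is a GRing.unit -> ~ divides p u.
Proof.
by case=> _ /negP pU _ uU [q uE]; apply: pU; move: uU; rewrite uE unitrM => /andP[].
Qed.

Lemma factors_as_mul a b s t :
  factors_as a s -> factors_as b t -> factors_as (a * b) (s ++ t).
Proof.
move=> [ps [u uU ->]] [pt [v vU ->]]; split.
  by move=> p; rewrite mem_cat => /orP[/ps|/pt].
by exists (u * v); rewrite ?unitrM ?uU // big_cat /=; ring.
Qed.

(** Some prime in [s] is associated to [p] and is struck out. The drop in length makes the
    extraction of contents terminate. *)
Lemma factors_as_div p a s :
  prime_elt p -> factors_as (p * a) s ->
  exists2 t, factors_as a t & size s = (size t).+1.
Proof.
elim: s p a => [|q s IH] p a pp [ps [u uU E]].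
  case: (prime_elt_ndivides_unit pp uU).
  by exists a; rewrite big_nil mulr1 in E; rewrite -E mulrC.
have qp := ps q (mem_head _ _); have [q0 qU qP] := qp.
have [p0 /negP pU pP] := pp.
have s_ok : forall r, r \in s -> prime_elt r.
  by move=> r rs; apply: ps; rewrite inE rs orbT.
rewrite big_cons in E.
have [] := qP p a; first by exists (u * \prod_(r <- s) r); rewrite E; ring.
  case=> v pE; exists s => //; split=> //.
  have vU : v \is a GRing.unit.
    have [] := pP v q; first by exists 1; rewrite mul1r pE.
      case=> x vE; case/negP: qU.
      have /(mulfI p0) : p * 1 = p * (x * q) by rewrite {1}pE {1}vE; ring.
      by move=> h; move: (unitr1 A); rewrite h unitrM => /andP[].
    case=> x qE.
    have /(mulfI p0) : p * 1 = p * (v * x) by rewrite {1}pE {1}qE; ring.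
    by move=> h; move: (unitr1 A); rewrite h unitrM => /andP[].
  exists (u * v^-1); first by rewrite unitrM uU unitrV.
  apply: (mulfI q0); apply: (mulfI (x := v)); first by apply: contraTneq vU => ->; rewrite unitr0.
  have vK := mulrV vU; move: vK; set w := v^-1; set m := \prod_(_ <- _) _ => vK.
  by rewrite mulrA -pE E -/m -[LHS]mul1r -vK; ring.
case=> x aE; have E' : p * x = u * \prod_(r <- s) r.
  by apply: (mulfI q0); rewrite -[RHS]mulrCA -E aE; ring.
have [t [tp [v vU xE]] st] : exists2 t, factors_as x t & size s = (size t).+1.
  by apply: (IH p) => //; split=> //; exists u.
exists (q :: t); last by rewrite /= st.
split; first by move=> r; rewrite inE => /orP[/eqP->|/tp].
by exists v => //; rewrite big_cons aE xE; ring.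
Qed.

(** Induction on a prime factorization of [q]: a prime that divides what is left of [p] moves into
    the common factor, any other stays in [q']. *)
Lemma rel_prime_gcd : ufd -> forall p q, p != 0 -> q != 0 ->
  exists d p' q', [/\ p = d * p', q = d * q' & rel_prime p' q'].
Proof.
move=> fA p q p0 /fA [s]; elim: s q => [|r s IH] q [ps [u uU ->]].
  exists 1, p, (u * 1); rewrite !mul1r big_nil; split=> // a b _.
  by exists (a * u^-1); rewrite mulr1 -mulrA mulVr // mulr1.
have rp := ps r (mem_head _ _); have [r0 rU rP] := rp.
have [|d [p' [q' [pE qE rpq]]]] := IH (u * \prod_(i <- s) i).
  split; last by exists u.
  by move=> i si; apply: ps; rewrite inE si orbT.
have [[x xE]|nd] := classic (divides r p').
  exists (d * r), x, q'; split.
  - by rewrite pE xE; ring.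
  - by rewrite big_cons mulrCA qE; ring.
  move=> a b E; apply: (rpq a (b * r)); rewrite xE.
  by rewrite [LHS]mulrA E; ring.
exists d, p', (r * q'); split=> //.
  by rewrite big_cons mulrCA qE; ring.
move=> a b E; have [] := rP a p'; first by exists (b * q'); rewrite E; ring.
  case=> x aE; have [|y yE] := rpq x b.
    by apply: (mulfI r0); rewrite aE in E; rewrite -[RHS]mulrCA -E; ring.
  by exists y; rewrite aE yE; ring.
by [].
Qed.

End Divisibility.

Lemma field_ufd (F : fieldType) : ufd F.
Proof.
move=> a a0; exists [::]; split=> //.
by exists a; rewrite ?unitfE // big_nil mulr1.
Qed.

(** * Gauss's lemma and factorization in polynomial rings *)

Section Gauss.
Variable A : idomainType.
Implicit Types (c : A) (P Q S : {poly A}).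

(** Gauss's lemma. As [c] divides the product of the leading coefficients, it divides one of them;
    removing that leading term preserves the hypothesis and lowers the total size. *)
Lemma prime_elt_polyC c : prime_elt c -> prime_elt c%:P.
Proof.
move=> [c0 cU cP]; split; rewrite ?polyC_eq0 ?poly_unitE ?coefC ?eqxx ?(negbTE cU) ?andbF //.
have dC P : divides c%:P P -> divides c (lead_coef P).
  by case=> q ->; exists (lead_coef q); rewrite lead_coefM lead_coefC.
have dX (d : A) n : divides c d -> divides c%:P (d *: 'X^n).
  by case=> e ->; exists (e *: 'X^n); rewrite -!mul_polyC polyCM; ring.
have top P : P != 0 -> (size (P - lead_coef P *: 'X^((size P).-1))%R < size P)%N.
  move=> P0; have sP : (0 < size P)%N by rewrite size_poly_gt0.
  rewrite -(prednK sP) ltnS; apply/leq_sizeP => j hj.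
  rewrite coefB coefZ coefXn; have [->|ne] := eqVneq j (size P).-1.
    by rewrite mulr1 /lead_coef subrr.
  by rewrite mulr0 subr0 nth_default // -(prednK sP) ltn_neqAle eq_sym ne hj.
move=> P Q; have [n] := ubnP (size P + size Q); elim: n P Q => // n IH P Q ltn dPQ.
have [->|P0] := eqVneq P 0; first by left; exists 0; rewrite mul0r.
have [->|Q0] := eqVneq Q 0; first by right; exists 0; rewrite mul0r.
have := dC _ dPQ; rewrite lead_coefM => /cP[] h; have {h} := dX _ _ h => h.
- have [| |h'|] := IH (P - lead_coef P *: 'X^((size P).-1)) Q; last by right.
  + by rewrite -ltnS; apply: leq_trans ltn; rewrite ltnS ltn_add2r top.
  + rewrite mulrBl; apply: dividesB => //; exact: (divides_mulr _ (h _)).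
  + left; rewrite -[P](subrK (lead_coef P *: 'X^((size P).-1))); exact: dividesD.
- have [| | |h'] := IH P (Q - lead_coef Q *: 'X^((size Q).-1)); last 2 first.
  + by left.
  + right; rewrite -[Q](subrK (lead_coef Q *: 'X^((size Q).-1))); exact: dividesD.
  + by rewrite -ltnS; apply: leq_trans ltn; rewrite ltnS ltn_add2l top.
  + rewrite mulrBr; apply: dividesB => //; exact: (divides_mull _ (h _)).
Qed.

Definition primitive P := forall c, prime_elt c -> ~ divides c%:P P.

Hypothesis fA : ufd A.

(** Prime constants are divided out one at a time; each lowers the number of prime factors of the
    leading coefficient. *)
Lemma content_primitive P : P != 0 ->
  exists c Q, [/\ c != 0, P = c *: Q & primitive Q].
Proof.
move=> P0; have [|s sP] := @fA (lead_coef P); first by rewrite lead_coef_eq0.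
have [n] := ubnP (size s); elim: n P P0 s sP => // n IH P P0 s sP ltn.
have [[c [cp [Q PE]]]|np] := classic (exists c, prime_elt c /\ divides c%:P P); last first.
  by exists 1, P; rewrite scale1r oner_eq0; split=> // c cp dc; apply: np; exists c.
have Q0 : Q != 0 by apply: contraNneq P0 => h; rewrite PE h mul0r.
have [t tP st] : exists2 t, factors_as (lead_coef Q) t & size s = (size t).+1.
  apply: (factors_as_div cp); suff <- : lead_coef P = c * lead_coef Q by [].
  by rewrite PE lead_coefM lead_coefC mulrC.
have [|d [S [d0 QE Sp]]] := IH Q Q0 t tP; first by rewrite st in ltn.
exists (c * d), S; split=> //; first by case: cp => c0 _ _; rewrite mulf_neq0.
by rewrite PE QE -!mul_polyC polyCM; ring.
Qed.


(** Takes a factorization over the fraction field back to [A]: each prime factor of the denominator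
    [c] divides [Q] or [S] and is cancelled there. *)
Lemma scale_factor_clear c P Q S : c != 0 -> c *: P = Q * S ->
  exists Q' S', [/\ P = Q' * S', size Q' = size Q & size S' = size S].
Proof.
move=> /fA [s]; elim: s c P Q S => [|p s IH] c P Q S [ps [u uU ->]] E.
  rewrite big_nil mulr1 in E; exists (u^-1 *: Q), S; split=> //.
    by rewrite -scalerAl -E scalerA mulVr // scale1r.
  by rewrite size_scale // invr_neq0 //; apply: contraTneq uU => ->; rewrite unitr0.
have [p0 _ _] := ps p (mem_head _ _); have [_ _ pP] := prime_elt_polyC (ps p (mem_head _ _)).
rewrite big_cons mulrCA -scalerA in E.
have pI : injective ( *:%R p : {poly A} -> _).
  by move=> X Y /eqP; rewrite -!mul_polyC => /eqP /mulfI; apply; rewrite polyC_eq0.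
have fs : factors_as (u * \prod_(j <- s) j) s.
  split; last by exists u.
  by move=> i si; apply: ps; rewrite inE si orbT.
have sz T : size (T * p%:P) = size T by rewrite mulrC mul_polyC size_scale.
have [] := pP Q S; first by exists ((u * \prod_(j <- s) j) *: P); rewrite -E -(mul_polyC p) mulrC.
  case=> Q1 QE; have [|Q' [S' [-> e1 e2]]] := IH _ P Q1 S fs.
    by apply: pI; rewrite E QE -!mul_polyC; ring.
  by exists Q', S'; rewrite QE sz.
case=> S1 SE; have [|Q' [S' [-> e1 e2]]] := IH _ P Q S1 fs.
  by apply: pI; rewrite E SE -!mul_polyC; ring.
by exists Q', S'; rewrite SE sz.
Qed.

(** The same cancellation; a prime factor of [c] cannot divide the primitive [P], so it always
    divides the cofactor [S]. *)
Lemma primitive_divides_clear c P Q S : primitive P -> c != 0 ->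
  c *: Q = S * P -> divides P Q.
Proof.
move=> pP /fA [s]; elim: s c S => [|p s IH] c S [ps [u uU ->]] E.
  rewrite big_nil mulr1 in E; exists (u^-1 *: S).
  by rewrite -scalerAl -E scalerA mulVr // scale1r.
have pp := ps p (mem_head _ _); have [p0 _ _] := pp.
have [_ _ ppP] := prime_elt_polyC pp.
rewrite big_cons mulrCA -scalerA in E.
have [|[S1 SE]|/(pP _ pp) //] := ppP S P.
  by exists ((u * \prod_(j <- s) j) *: Q); rewrite -E -(mul_polyC p) mulrC.
apply: (IH (u * \prod_(j <- s) j) S1).
  split; last by exists u.
  by move=> i si; apply: ps; rewrite inE si orbT.
have /mulfI : p%:P != 0 by rewrite polyC_eq0.
by apply; rewrite mul_polyC E SE; ring.
Qed.

(** [%|] is divisibility over the fraction field. By irreducibility the gcd of [P] and [Q] either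
    has the size of [P], so that [P] divides [Q], or is constant, so that [P] divides [S];
    [primitive_divides_clear] descends this to [A]. *)
Lemma prime_elt_primitive P : primitive P -> (1 < size P)%N ->
  (forall Q S, P = Q * S -> (size Q <= 1)%N \/ (size S <= 1)%N) -> prime_elt P.
Proof.
move=> pP sP irrP; have P0 : P != 0 by rewrite -size_poly_gt0 (leq_trans _ sP).
split=> //; first by rewrite poly_unitE; case: eqP => // h; rewrite h in sP.
move=> Q S [T QSE].
have : gcdp P Q %| P by apply: dvdp_gcdl.
case/Pdiv.WeakIdomain.dvdpP=> -[c D] /= c0 PE.
have [P1 [P2 [PE' s1 s2]]] := scale_factor_clear c0 PE.
have dvd_div U : P %| U -> divides P U.
  by case/Pdiv.WeakIdomain.dvdpP=> -[d D'] /= d0 UE; apply: (primitive_divides_clear pP d0 UE).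
have G0 : gcdp P Q != 0 by rewrite gcdp_eq0 negb_and P0.
have [] := irrP _ _ PE'; rewrite ?s1 ?s2 => le1.
  left; apply: dvd_div; apply: dvdp_trans (dvdp_gcdr P Q).
  have D0 : D != 0 by apply: contraNneq P0 => D0; rewrite -size_poly_eq0 -(size_scale P c0) PE D0 mul0r size_poly0.
  have /dvdp_size_eqp := dvdp_gcdl P Q.
  have -> : size (gcdp P Q) = size P.
    by rewrite -(size_scale P c0) PE size_mul //; have := size_poly_gt0 D; rewrite D0; lia.
  by rewrite eqxx => /esym; rewrite /eqp => /andP[].
right; apply: dvd_div.
have cop : coprimep P Q.
  by rewrite coprimep_def; have := size_poly_gt0 (gcdp P Q); rewrite G0; lia.
by rewrite -(Gauss_dvdpr S cop) QSE dvdp_mull.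
Qed.

Lemma poly_ufd : ufd {poly A}.
Proof.
have constP c : c != 0 -> exists s, factors_as c%:P s.
  move=> /fA [s [ps [u uU ->]]]; exists (map polyC s); split.
    by move=> p /mapP[q qs ->]; apply/prime_elt_polyC/ps.
  have u0 : u != 0 by apply: contraTneq uU => ->; rewrite unitr0.
  exists u%:P; first by rewrite poly_unitE size_polyC coefC u0 uU.
  by rewrite polyCM rmorph_prod big_map.
move=> P; have [n] := ubnP (size P); elim: n P => // n IH P ltn P0.
have [c [Q [c0 PE pQ]]] := content_primitive P0.
have sPQ : size P = size Q by rewrite PE size_scale.
suff [s sQ] : exists s, factors_as Q s.
  have [t tc] := constP c c0; exists (t ++ s).
  by rewrite PE -mul_polyC; apply: factors_as_mul.
have Q0 : Q != 0 by apply: contraNneq P0 => h; rewrite PE h scaler0.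
have [/size1_polyC QE|lt1] := leqP (size Q) 1.
  by rewrite QE; apply: constP; rewrite -polyC_eq0 -QE.
have [[S [T [QE sS sT]]]|irr] := classic (exists S T, [/\ Q = S * T, (1 < size S)%N & (1 < size T)%N]).
  have S0 : S != 0 by apply: contraNneq Q0 => h; rewrite QE h mul0r.
  have T0 : T != 0 by apply: contraNneq Q0 => h; rewrite QE h mulr0.
  have sQ : size Q = (size S + size T).-1 by rewrite QE size_mul.
  have [||s1 f1] := IH S => //; first lia.
  have [||s2 f2] := IH T => //; first lia.
  by exists (s1 ++ s2); rewrite QE; apply: factors_as_mul.
exists [:: Q]; split; last by exists 1; rewrite ?unitr1 // big_seq1 mul1r.
move=> p; rewrite inE => /eqP->; apply: prime_elt_primitive => // S T QE.
have [|h1] := leqP (size S) 1; first by left.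
have [|h2] := leqP (size T) 1; first by right.
by case: irr; exists S, T.
Qed.
End Gauss.

(** * Height of a principal prime *)

Section PrincipalHeight.
Variable A : idomainType.

Lemma principal_prime_ideal (p : A) : prime_elt p -> prime_ideal (divides p).
Proof.
move=> pp; have [p0 pU pP] := pp; split=> //.
- by exists 0; rewrite mul0r.
- exact: dividesD.
- by move=> r a; apply: divides_mull.
- by apply: prime_elt_ndivides_unit => //; apply: unitr1.
Qed.

(** In a chain Q0 < Q1 < Q2 = (p) the element [p] is not in Q1, so each element of Q1 is [p] times
    another element of Q1. A nonzero element of Q1 would then be divisible by all powers of [p]. *)
Lemma principal_height1 (p : A) (P : A -> Prop) : prime_elt p ->
  (forall a : A, a != 0 -> exists n, ~ divides (p ^+ n) a) ->
  prime_ideal P -> eqI P (divides p) -> height_eq P 1.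
Proof.
move=> pp mult Pp PE; split=> //.
  exists (fun n => if n is 0 then (fun h => h = 0) else P); split=> //.
  - case=> // _; split=> //.
    + by move=> a b -> ->; rewrite addr0.
    + by move=> r a ->; rewrite mulr0.
    + by apply/eqP; rewrite oner_eq0.
    + by move=> a b /eqP; rewrite mulf_eq0 => /orP[] /eqP; [left|right].
  - case=> // _; split; first by case: Pp => P0 _ _ _ _ h ->.
    exists p; split; first by apply/PE; exists 1; rewrite mul1r.
    by case: pp => /eqP.
move=> [Q [Qp Qs QE]]; have [sub1 [a [aQ1 aQ0]]] := Qs 0 isT.
have [sub2 [b [bQ2 bQ1]]] := Qs 1 isT.
have [_ _ Q1M _ Q1P] := Qp 1 isT; have [Q00 _ _ _ _] := Qp 0 isT.
have npQ1 : ~ Q 1 p.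
  by move=> pQ1; apply: bQ1; have /QE/PE[q ->] := bQ2; apply: Q1M.
have a0 : a != 0 by apply/eqP => h; apply: aQ0; rewrite h.
have [n] := mult a a0; apply.
suff [c aE _] : exists2 c, a = c * p ^+ n & Q 1 c by exists c.
elim: n => [|n [c aE cQ]]; first by exists a; rewrite ?mulr1.
have /QE/PE[d cE] := sub2 _ cQ.
exists d; first by rewrite aE cE exprS mulrA.
by have [] := Q1P d p; rewrite -?cE.
Qed.
End PrincipalHeight.

(** * Gradings and polynomial rings in two and four variables *)

(** After the powers of X are split off, the cofactors do not vanish at 0 while their product is
    still a monomial; hence that product is constant. This makes factors of homogeneous elements
    homogeneous. *)
Lemma monomial_factor (A : idomainType) (P Q : {poly A}) (c : A) n :
  c != 0 -> P * Q = c *: 'X^n -> exists a e, P = a *: 'X^e.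
Proof.
move=> c0 E; have [e [P' P'0 PE]] := multiplicity_XsubC P 0.
have [e' [Q' Q'0 QE]] := multiplicity_XsubC Q 0.
have PQ0 : P * Q != 0.
  by rewrite E -size_poly_eq0 size_scale // size_polyXn.
have [P0 Q0] : P != 0 /\ Q != 0 by move: PQ0; rewrite mulf_eq0 negb_or => /andP.
rewrite P0 /= in P'0; rewrite Q0 /= in Q'0.
rewrite subr0 in PE QE.
have E' : P' * Q' * 'X^(e + e') = c *: 'X^n by rewrite -E PE QE exprD; ring.
have nr : ~~ root (P' * Q') 0 by rewrite rootM negb_or P'0.
have X0 m : 'X^m != 0 :> {poly A} by rewrite -size_poly_eq0 size_polyXn.
have le1 : (e + e' <= n)%N.
  rewrite leqNgt; apply/negP => lt; move: c0; rewrite -[c](hornerC c 0); have := E'.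
  rewrite -(subnK lt) addnS -addSn exprD mulrA -mul_polyC => /(mulIf (X0 _)) <-.
  by rewrite hornerM hornerXn expr0n /= mulr0 eqxx.
have E2 : P' * Q' = c *: 'X^(n - (e + e')).
  by apply: (mulIf (X0 (e + e')%N)); rewrite E' -scalerAl -exprD subnK.
have n0 : (n - (e + e') = 0)%N.
  apply/eqP; move: nr; rewrite E2 /root hornerZ hornerXn expr0n.
  by case: (n - _)%N => // m; rewrite mulr0 eqxx.
rewrite n0 expr0 in E2.
have s1 : size (P' * Q') = 1 by rewrite E2 alg_polyC size_polyC c0.
have P'n0 : P' != 0 by apply: contraNneq P'0 => ->; rewrite root0.
have Q'n0 : Q' != 0 by apply: contraNneq Q'0 => ->; rewrite root0.
have /size1_polyC P'E : (size P' <= 1)%N.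
  move: s1; rewrite size_mul //; have := size_poly_gt0 P'; rewrite P'n0.
  have := size_poly_gt0 Q'; rewrite Q'n0.
  by case: (size P') => // [[|a]] //; case: (size Q') => //= b _ _; rewrite addnS.
by exists P'`_0, e; rewrite PE {1}P'E mul_polyC.
Qed.

(* A grading of [A] by [nat] is encoded as a coaction [tau : A -> A[T]],
   sending an element of degree [n] to its multiple by [T ^ n]. *)
Section Grading.
Variables (A : idomainType) (tau : {rmorphism A -> {poly A}}).

Definition homog n a := tau a = a *: 'X^n.
(** The highest degree of a component, with value 0 at [a = 0]. *)
Definition gdeg a := (size (tau a)).-1.

(** The axioms of a coaction: the counit, and coassociativity expressed on components. *)
Hypothesis tau1 : forall a, (tau a).[1] = a.
Hypothesis tauK : forall a n, homog n (tau a)`_n.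

Lemma tau_eq0 a : (tau a == 0) = (a == 0).
Proof.
apply/eqP/eqP => [h|->]; last by rewrite rmorph0.
by rewrite -[a]tau1 h horner0.
Qed.

Lemma homogM m n a b : homog m a -> homog n b -> homog (m + n) (a * b).
Proof. by rewrite /homog rmorphM => -> ->; rewrite exprD -!mul_polyC polyCM; ring. Qed.

Lemma homog_factor n a b : a * b != 0 -> homog n (a * b) -> exists e, homog e a.
Proof.
move=> ab0; rewrite /homog rmorphM => /(monomial_factor ab0)[c [e E]].
have ac : a = c by rewrite -[a]tau1 E hornerZ hornerXn expr1n mulr1.
by exists e; rewrite E ac.
Qed.

Lemma gdegM a b : a != 0 -> b != 0 -> gdeg (a * b) = (gdeg a + gdeg b)%N.
Proof.
move=> a0 b0; rewrite /gdeg rmorphM size_mul ?tau_eq0 //.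
have : (0 < size (tau a))%N by rewrite size_poly_gt0 tau_eq0.
have : (0 < size (tau b))%N by rewrite size_poly_gt0 tau_eq0.
by case: (size _) => // m; case: (size _) => // l; rewrite !addnS !addSn.
Qed.

Lemma gdegX a n : a != 0 -> gdeg (a ^+ n) = (n * gdeg a)%N.
Proof.
move=> a0; elim: n => [|n IH]; first by rewrite /gdeg rmorph1 size_poly1.
by rewrite exprS gdegM ?expf_neq0 // IH mulSn.
Qed.

Lemma homog_gdeg n a : a != 0 -> homog n a -> gdeg a = n.
Proof. by move=> a0; rewrite /gdeg => ->; rewrite size_scale // size_polyXn. Qed.

Lemma sum_homog a : a = \sum_(i < size (tau a)) (tau a)`_i.
Proof.
rewrite -{1}[a]tau1 horner_coef; apply: eq_bigr => i _.
by rewrite expr1n mulr1.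
Qed.
End Grading.


Definition comm_rm (B : nzRingType) (S : comNzRingType) (f : {rmorphism B -> S}) (u : S) :
  commr_rmorph f u := fun x => mulrC _ _.

Lemma mon_rescale (S : comNzRingType) (e w x y z T : S) ow ox oy oz a b c d :
  e * (w * T ^+ ow) ^+ a * (x * T ^+ ox) ^+ b * (y * T ^+ oy) ^+ c * (z * T ^+ oz) ^+ d =
  e * w ^+ a * x ^+ b * y ^+ c * z ^+ d * T ^+ (a * ow + b * ox + c * oy + d * oz).
Proof.
rewrite !exprMn -!exprM !exprD ![(_ * a)%N]mulnC ![(_ * b)%N]mulnC ![(_ * c)%N]mulnC.
by rewrite ![(_ * d)%N]mulnC; ring.
Qed.

(* Interfaces for k[x, y] and k[w, x, y, z]; [coef2 F a b] and [cf4 F a b c d]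
   are the coefficients of x^a y^b and w^a x^b y^c z^d. *)
Record poly2 (k : fieldType) := Poly2 {
  R2 :> idomainType;
  c2 : {rmorphism k -> R2};
  x2 : R2; y2 : R2;
  coef2 : R2 -> nat -> nat -> k;
  coef2D : forall F G a b, coef2 (F + G) a b = coef2 F a b + coef2 G a b;
  coef2_mon : forall e a b a' b',
    coef2 (c2 e * x2 ^+ a * y2 ^+ b) a' b' = if (a' == a) && (b' == b) then e else 0;
  ind2 : forall (P : R2 -> Prop) (F : R2),
    P 0 -> (forall G H, P G -> P H -> P (G + H)) ->
    (forall a b, coef2 F a b != 0 -> P (c2 (coef2 F a b) * x2 ^+ a * y2 ^+ b)) -> P F;
  ev2_ex : forall (S : comNzRingType) (c : {rmorphism k -> S}) (X Y : S),
    {f : {rmorphism R2 -> S} | [/\ f \o c2 =1 c, f x2 = X & f y2 = Y]};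
  ufd2 : ufd R2 }.

Record poly4 (k : fieldType) := Poly4 {
  R4c :> idomainType;
  c4 : {rmorphism k -> R4c};
  w4 : R4c; x4 : R4c; y4 : R4c; z4 : R4c;
  cf4 : R4c -> nat -> nat -> nat -> nat -> k;
  cf4D : forall F G a b c d, cf4 (F + G) a b c d = cf4 F a b c d + cf4 G a b c d;
  cf4_mon : forall e a b c d a' b' c' d',
    cf4 (c4 e * w4 ^+ a * x4 ^+ b * y4 ^+ c * z4 ^+ d) a' b' c' d' =
    if [&& a' == a, b' == b, c' == c & d' == d] then e else 0;
  ind4 : forall (P : R4c -> Prop) (F : R4c),
    P 0 -> (forall G H, P G -> P H -> P (G + H)) ->
    (forall a b c d, cf4 F a b c d != 0 ->
       P (c4 (cf4 F a b c d) * w4 ^+ a * x4 ^+ b * y4 ^+ c * z4 ^+ d)) -> P F;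
  ev4_ex : forall (S : comNzRingType) (c : {rmorphism k -> S}) (W X Y Z : S),
    {f : {rmorphism R4c -> S} | [/\ f \o c4 =1 c, f w4 = W, f x4 = X, f y4 = Y & f z4 = Z]};
  ufd4 : ufd R4c }.

Arguments x2 {k p}. Arguments y2 {k p}. Arguments c2 {k p}. Arguments coef2 {k p}.
Arguments w4 {k p}. Arguments x4 {k p}. Arguments y4 {k p}. Arguments z4 {k p}.
Arguments c4 {k p}. Arguments cf4 {k p}.

Section FourVars.
Variables (k : fieldType) (R : poly4 k).
Implicit Types F G : R.

Definition mon e a b c d : R := c4 e * w4 ^+ a * x4 ^+ b * y4 ^+ c * z4 ^+ d.

Lemma coef_mon e a b c d a' b' c' d' :
  cf4 (mon e a b c d) a' b' c' d' =
  if [&& a' == a, b' == b, c' == c & d' == d] then e else 0.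
Proof. exact: cf4_mon. Qed.

(** Only monomials that occur in [F] have to be treated, so hypotheses on the support of [F] remain
    available. *)
Lemma mon_ind (P : R -> Prop) F :
  P 0 -> (forall G H, P G -> P H -> P (G + H)) ->
  (forall a b c d, cf4 F a b c d != 0 -> P (mon (cf4 F a b c d) a b c d)) -> P F.
Proof. exact: ind4. Qed.

Lemma mon0 a b c d : mon 0 a b c d = 0.
Proof. by rewrite /mon rmorph0 !mul0r. Qed.

Lemma cf4_0 a b c d : cf4 (0 : R) a b c d = 0.
Proof. by rewrite -(mon0 a b c d) coef_mon; case: ifP. Qed.

Lemma cf4_neq0 F : F != 0 -> exists a b c d, cf4 F a b c d != 0.
Proof.
move=> F0; apply: NNPP => h; case/eqP: F0; apply: (mon_ind (P := fun F => F = 0)) => //.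
  by move=> G H -> ->; rewrite addr0.
by move=> a b c d cn; case: h; exists a, b, c, d.
Qed.

Section Ev.
Variables (S : comNzRingType) (c : {rmorphism k -> S}) (W X Y Z : S).
Definition ev : {rmorphism R -> S} := sval (ev4_ex R c W X Y Z).
Lemma ev_c e : ev (c4 e) = c e.
Proof. by rewrite /ev; case: ev4_ex => f /= [fc _ _ _ _]; apply: fc. Qed.
Lemma evw : ev w4 = W.
Proof. by rewrite /ev; case: ev4_ex => f /= []. Qed.
Lemma evx : ev x4 = X.
Proof. by rewrite /ev; case: ev4_ex => f /= []. Qed.
Lemma evy : ev y4 = Y.
Proof. by rewrite /ev; case: ev4_ex => f /= []. Qed.
Lemma evz : ev z4 = Z.
Proof. by rewrite /ev; case: ev4_ex => f /= []. Qed.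
Definition evE := (ev_c, evw, evx, evy, evz).
Lemma ev_mon e a b c' d : ev (mon e a b c' d) = c e * W ^+ a * X ^+ b * Y ^+ c' * Z ^+ d.
Proof. by rewrite /mon !rmorphM !rmorphXn !evE. Qed.
End Ev.

Lemma ev_unique (S : comNzRingType) (f g : {rmorphism R -> S}) :
  (forall e, f (c4 e) = g (c4 e)) -> f w4 = g w4 -> f x4 = g x4 -> f y4 = g y4 ->
  f z4 = g z4 -> f =1 g.
Proof.
move=> fc fw fx fy fz F; apply: (mon_ind (P := fun F => f F = g F)).
- by rewrite !rmorph0.
- by move=> G H fG fH; rewrite !rmorphD fG fH.
by move=> a b c d _; rewrite /mon !rmorphM !rmorphXn fc fw fx fy fz.
Qed.

Section Coaction.
Variables ow ox oy oz : nat.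
Definition coact : {rmorphism R -> {poly R}} :=
  ev (polyC \o c4) (w4 *: 'X^ow) (x4 *: 'X^ox) (y4 *: 'X^oy) (z4 *: 'X^oz).
Definition wt a b c d := (a * ow + b * ox + c * oy + d * oz)%N.

Lemma coact_mon e a b c d : homog coact (wt a b c d) (mon e a b c d).
Proof.
rewrite /homog /coact ev_mon -!mul_polyC mon_rescale.
by rewrite /mon !(rmorphM polyC) !(rmorphXn polyC).
Qed.

Lemma coact1 F : (coact F).[1] = F.
Proof.
apply: (mon_ind (P := fun F => (coact F).[1] = F)).
- by rewrite rmorph0 horner0.
- by move=> G H hG hH; rewrite rmorphD hornerD hG hH.
by move=> a b c d _; rewrite coact_mon hornerZ hornerXn expr1n mulr1.
Qed.

Lemma coactK F n : homog coact n (coact F)`_n.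
Proof.
apply: (mon_ind (P := fun F => homog coact n (coact F)`_n)).
- by rewrite /homog rmorph0 coef0 rmorph0 scale0r.
- by move=> G H; rewrite /homog rmorphD coefD rmorphD scalerDl => -> ->.
move=> a b c d _; rewrite coact_mon coefZ coefXn.
case: eqP => [->|_]; first by rewrite mulr1; exact: coact_mon.
by rewrite mulr0 /homog rmorph0 scale0r.
Qed.

Lemma cf4_coact n F a b c d :
  cf4 (coact F)`_n a b c d = if wt a b c d == n then cf4 F a b c d else 0.
Proof.
apply: (mon_ind (P := fun F => cf4 (coact F)`_n a b c d = if wt a b c d == n then cf4 F a b c d else 0)).
- by rewrite rmorph0 coef0 cf4_0 if_same.
- by move=> G H hG hH; rewrite rmorphD coefD !cf4D hG hH; case: ifP; rewrite ?addr0.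
move=> a' b' c' d' _; rewrite coact_mon coefZ coefXn coef_mon.
case: (@eqP _ n) => [nE|h].
  rewrite mulr1 coef_mon; case: ifP => [/and4P[/eqP h1 /eqP h2 /eqP h3 /eqP h4]|]; last by rewrite if_same.
  by rewrite h1 h2 h3 h4 nE eqxx.
rewrite mulr0 cf4_0; case: ifP => // /eqP wE.
case: ifP => // /and4P[/eqP h1 /eqP h2 /eqP h3 /eqP h4].
by case: h; rewrite -h1 -h2 -h3 -h4 wE.
Qed.
Lemma homog_coef n F :
  homog coact n F <-> (forall a b c d, cf4 F a b c d != 0 -> wt a b c d = n).
Proof.
split=> [hF a b c d|hF]; last first.
  apply: (mon_ind (P := homog coact n)).
  - by rewrite /homog rmorph0 scale0r.
  - by move=> G H; rewrite /homog rmorphD scalerDl => -> ->.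
  by move=> a b c d /hF <-; apply: coact_mon.
apply: contraNeq => ne.
have := cf4_coact (wt a b c d) F a b c d; rewrite eqxx.
by rewrite hF coefZ coefXn (negbTE ne) mulr0 cf4_0 => <-.
Qed.

End Coaction.
End FourVars.

Section TwoVars.
Variables (k : fieldType) (S : poly2 k).
Implicit Types F G : S.

Definition mon2 e a b : S := c2 e * x2 ^+ a * y2 ^+ b.

Lemma coef2_mon2 e a b a' b' :
  coef2 (mon2 e a b) a' b' = if (a' == a) && (b' == b) then e else 0.
Proof. exact: coef2_mon. Qed.

Lemma mon2_ind (P : S -> Prop) F :
  P 0 -> (forall G H, P G -> P H -> P (G + H)) ->
  (forall a b, coef2 F a b != 0 -> P (mon2 (coef2 F a b) a b)) -> P F.
Proof. exact: ind2. Qed.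

Lemma mon20 a b : mon2 0 a b = 0.
Proof. by rewrite /mon2 rmorph0 !mul0r. Qed.

Lemma coef2_0 a b : coef2 (0 : S) a b = 0.
Proof. by rewrite -(mon20 a b) coef2_mon2; case: ifP. Qed.

Lemma coef2_inj F : (forall a b, coef2 F a b = 0) -> F = 0.
Proof.
move=> h; apply: (mon2_ind (P := fun F => F = 0)) => //.
  by move=> G H -> ->; rewrite addr0.
by move=> a b; rewrite h eqxx.
Qed.

Section Ev2.
Variables (T : comNzRingType) (c : {rmorphism k -> T}) (X Y : T).
Definition ev2 : {rmorphism S -> T} := sval (ev2_ex S c X Y).
Lemma ev2_c e : ev2 (c2 e) = c e.
Proof. by rewrite /ev2; case: ev2_ex => f /= [fc _ _]; apply: fc. Qed.
Lemma ev2x : ev2 x2 = X.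
Proof. by rewrite /ev2; case: ev2_ex => f /= []. Qed.
Lemma ev2y : ev2 y2 = Y.
Proof. by rewrite /ev2; case: ev2_ex => f /= []. Qed.
Definition ev2E := (ev2_c, ev2x, ev2y).
Lemma ev2_mon e a b : ev2 (mon2 e a b) = c e * X ^+ a * Y ^+ b.
Proof. by rewrite /mon2 !rmorphM !rmorphXn !ev2E. Qed.
End Ev2.

Section Coaction2.
Variables ox oy : nat.
Definition coact2 : {rmorphism S -> {poly S}} :=
  ev2 (polyC \o c2) (x2 *: 'X^ox) (y2 *: 'X^oy).

Lemma coact2_mon e a b : homog coact2 (a * ox + b * oy) (mon2 e a b).
Proof.
rewrite /homog /coact2 ev2_mon /= -!mul_polyC !exprMn -!exprM /mon2 !rmorphM !rmorphXn exprD.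
by rewrite ![(_ * a)%N]mulnC ![(_ * b)%N]mulnC; ring.
Qed.

Lemma coact2_1 F : (coact2 F).[1] = F.
Proof.
apply: (mon2_ind (P := fun F => (coact2 F).[1] = F)).
- by rewrite rmorph0 horner0.
- by move=> G H hG hH; rewrite rmorphD hornerD hG hH.
by move=> a b _; rewrite coact2_mon hornerZ hornerXn expr1n mulr1.
Qed.

Lemma coact2K F n : homog coact2 n (coact2 F)`_n.
Proof.
apply: (mon2_ind (P := fun F => homog coact2 n (coact2 F)`_n)).
- by rewrite /homog rmorph0 coef0 rmorph0 scale0r.
- by move=> G H; rewrite /homog rmorphD coefD rmorphD scalerDl => -> ->.
move=> a b _; rewrite coact2_mon coefZ coefXn.
case: eqP => [->|_]; first by rewrite mulr1; exact: coact2_mon.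
by rewrite mulr0 /homog rmorph0 scale0r.
Qed.

Lemma coef2_coact2 n F a b :
  coef2 (coact2 F)`_n a b = if (a * ox + b * oy == n)%N then coef2 F a b else 0.
Proof.
apply: (mon2_ind (P := fun F => coef2 (coact2 F)`_n a b = if (a * ox + b * oy == n)%N then coef2 F a b else 0)).
- by rewrite rmorph0 coef0 coef2_0 if_same.
- by move=> G H hG hH; rewrite rmorphD coefD !coef2D hG hH; case: ifP; rewrite ?addr0.
move=> a' b' _; rewrite coact2_mon coefZ coefXn coef2_mon2.
case: (@eqP _ n) => [nE|h].
  rewrite mulr1 coef2_mon2; case: ifP => [/andP[/eqP h1 /eqP h2]|]; last by rewrite if_same.
  by rewrite h1 h2 nE eqxx.
rewrite mulr0 coef2_0; case: ifP => // /eqP wE.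
case: ifP => // /andP[/eqP h1 /eqP h2].
by case: h; rewrite -h1 -h2 wE.
Qed.
End Coaction2.
End TwoVars.
Arguments ev {k R S} c W X Y Z.
Arguments coact {k R} ow ox oy oz.
Arguments mon {k R} e a b c d.
Arguments ev2 {k S T} c X Y.
Arguments coact2 {k S} ox oy.
Arguments mon2 {k S} e a b.

(** * Nested polynomials *)

Section NestedTwoVars.
Variable k : fieldType.
Local Notation S := {poly {poly k}}.

Definition nc2 : {rmorphism k -> S} := polyC \o polyC.

Lemma ncoef2_mon (e : k) a b a' b' :
  (nc2 e * 'X%:P ^+ a * 'X ^+ b : S)`_b'`_a' = if (a' == a) && (b' == b) then e else 0.
Proof.
rewrite /nc2 /= -!rmorphXn /= -!polyCM.
rewrite coefMXn; case: ltngtP => [ltd|ltd|->]; rewrite ?andbF ?coef0 //.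
  by rewrite coefC subn_eq0 leqNgt ltd /= !coef0.
rewrite subnn coefC eqxx coefMXn; case: ltngtP => [ltd|ltd|->]; rewrite ?andbF ?coef0 //.
  by rewrite coefC subn_eq0 leqNgt ltd.
by rewrite subnn coefC.
Qed.

Lemma nind2 (P : S -> Prop) (F : S) :
  P 0 -> (forall G H, P G -> P H -> P (G + H)) ->
  (forall a b, F`_b`_a != 0 -> P (nc2 F`_b`_a * 'X%:P ^+ a * 'X ^+ b)) -> P F.
Proof.
move=> P0 PD Pm.
have Psum (I : Type) (r : seq I) (G : I -> S) : (forall i, P (G i)) -> P (\sum_(i <- r) G i).
  by move=> PG; elim/big_ind: _.
have Pm' a b : P (nc2 F`_b`_a * 'X%:P ^+ a * 'X ^+ b).
  have [h|] := eqVneq F`_b`_a 0; last exact: Pm.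
  by rewrite h rmorph0 !mul0r.
rewrite -[F]coefK poly_def; apply: (@Psum) => b.
rewrite -[F`_b]coefK poly_def scaler_suml; apply: (@Psum) => a.
have := Pm' a b; congr P; rewrite /nc2 /=.
rewrite -!mul_polyC !polyCM !rmorphXn /=; ring.
Qed.

Lemma nev2_ex (T : comNzRingType) (c : {rmorphism k -> T}) (X Y : T) :
  {f : {rmorphism S -> T} | [/\ f \o nc2 =1 c, f ('X%:P) = X & f 'X = Y]}.
Proof.
pose f1 : {rmorphism {poly k} -> T} := horner_morph (comm_rm c X).
exists (horner_morph (comm_rm f1 Y)); split.
- move=> e; exact: etrans (horner_morphC (comm_rm f1 Y) _) (horner_morphC (comm_rm c X) _).
- exact: etrans (horner_morphC (comm_rm f1 Y) _) (horner_morphX (comm_rm c X)).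
- exact: (horner_morphX (comm_rm f1 Y)).
Qed.

Definition nested_poly2 : poly2 k :=
  @Poly2 k {poly {poly k}} nc2 'X%:P 'X (fun F a b => F`_b`_a)
    (fun F G a b => etrans (congr1 (fun p : {poly k} => p`_a) (coefD F G b)) (coefD _ _ a))
    ncoef2_mon nind2 nev2_ex (poly_ufd (poly_ufd (@field_ufd k))).
End NestedTwoVars.
Section NestedFourVars.
Variable k : fieldType.

Definition ncst (e : k) : R4 k := e%:P%:P%:P%:P.
Definition nwv : R4 k := 'X%:P%:P%:P.
Definition nxv : R4 k := 'X%:P%:P.
Definition nyv : R4 k := 'X%:P.
Definition nzv : R4 k := 'X.
Definition nmon e a b c d : R4 k := ncst e * nwv ^+ a * nxv ^+ b * nyv ^+ c * nzv ^+ d.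

Lemma ncoef4_mon e a b c d a' b' c' d' :
  coef4 (nmon e a b c d) a' b' c' d' =
  if [&& a' == a, b' == b, c' == c & d' == d] then e else 0.
Proof.
rewrite /coef4 /nmon /ncst /nwv /nxv /nyv /nzv -!rmorphXn /= -!polyCM.
rewrite coefMXn; case: ltngtP => [ltd|ltd|->]; rewrite ?andbF ?coef0 //.
  by rewrite coefC subn_eq0 leqNgt ltd /= !coef0.
rewrite subnn coefC eqxx coefMXn; case: ltngtP => [ltd|ltd|->]; rewrite ?andbF ?coef0 //.
  by rewrite coefC subn_eq0 leqNgt ltd /= !coef0.
rewrite subnn coefC eqxx coefMXn; case: ltngtP => [ltd|ltd|->]; rewrite ?andbF ?coef0 //.
  by rewrite coefC subn_eq0 leqNgt ltd /= !coef0.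
rewrite subnn coefC !eqxx coefMXn; case: ltngtP => [ltd|ltd|->]; rewrite ?andbF ?coef0 //.
  by rewrite coefC subn_eq0 leqNgt ltd.
by rewrite subnn coefC.
Qed.

Lemma ncoef4D (F G : R4 k) a b c d : coef4 (F + G) a b c d = coef4 F a b c d + coef4 G a b c d.
Proof. by rewrite /coef4 !coefD. Qed.

Lemma nR4_ind_supp (P : R4 k -> Prop) (F : R4 k) :
  P 0 -> (forall G H, P G -> P H -> P (G + H)) ->
  (forall a b c d, coef4 F a b c d != 0 -> P (nmon (coef4 F a b c d) a b c d)) ->
  P F.
Proof.
move=> P0 PD Pm.
have Psum (I : Type) (r : seq I) (G : I -> R4 k) : (forall i, P (G i)) -> P (\sum_(i <- r) G i).
  by move=> PG; elim/big_ind: _.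
have Pm' a b c d : P (nmon (coef4 F a b c d) a b c d).
  have [h|] := eqVneq (coef4 F a b c d) 0; last exact: Pm.
  by rewrite h /nmon /ncst !polyC0 !mul0r.
rewrite -[F]coefK poly_def; apply: (@Psum) => d.
rewrite -[F`_d]coefK poly_def scaler_suml; apply: (@Psum) => c.
rewrite -[F`_d`_c]coefK poly_def scaler_suml scaler_suml; apply: (@Psum) => b.
rewrite -[F`_d`_c`_b]coefK poly_def !scaler_suml; apply: (@Psum) => a.
have := Pm' a b c d; congr P; rewrite /nmon /ncst /nwv /nxv /nyv /nzv /coef4.
rewrite -!mul_polyC !polyCM !rmorphXn /=; ring.
Qed.

Section NestedEv.
Variables (S : comNzRingType) (c : {rmorphism k -> S}) (W X Y Z : S).
Definition nev_w : {rmorphism {poly k} -> S} := horner_morph (comm_rm c W).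
Definition nev_x : {rmorphism {poly {poly k}} -> S} := horner_morph (comm_rm nev_w X).
Definition nev_y : {rmorphism {poly {poly {poly k}}} -> S} := horner_morph (comm_rm nev_x Y).
Definition nev : {rmorphism R4 k -> S} := horner_morph (comm_rm nev_y Z).

Lemma nev_polyC q : nev q%:P = nev_y q.
Proof. exact: (horner_morphC (comm_rm nev_y Z)). Qed.
Lemma nev_y_polyC q : nev_y q%:P = nev_x q.
Proof. exact: (horner_morphC (comm_rm nev_x Y)). Qed.
Lemma nev_x_polyC q : nev_x q%:P = nev_w q.
Proof. exact: (horner_morphC (comm_rm nev_w X)). Qed.
Lemma nev_w_polyC q : nev_w q%:P = c q.
Proof. exact: (horner_morphC (comm_rm c W)). Qed.
Lemma nev_cst e : nev (ncst e) = c e.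
Proof. exact: etrans (nev_polyC _) (etrans (nev_y_polyC _) (etrans (nev_x_polyC _) (nev_w_polyC _))). Qed.
Lemma nevw : nev nwv = W.
Proof. exact: etrans (nev_polyC _) (etrans (nev_y_polyC _) (etrans (nev_x_polyC _) (horner_morphX (comm_rm c W)))). Qed.
Lemma nevx : nev nxv = X.
Proof. exact: etrans (nev_polyC _) (etrans (nev_y_polyC _) (horner_morphX (comm_rm nev_w X))). Qed.
Lemma nevy : nev nyv = Y.
Proof. exact: etrans (nev_polyC _) (horner_morphX (comm_rm nev_x Y)). Qed.
Lemma nevz : nev nzv = Z.
Proof. exact: (horner_morphX (comm_rm nev_y Z)). Qed.
End NestedEv.

Definition nc4 : {rmorphism k -> R4 k} := polyC \o (polyC \o (polyC \o polyC)).

Lemma nev4_ex (S : comNzRingType) (c : {rmorphism k -> S}) (W X Y Z : S) :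
  {f : {rmorphism R4 k -> S} |
    [/\ f \o nc4 =1 c, f nwv = W, f nxv = X, f nyv = Y & f nzv = Z]}.
Proof.
exists (nev c W X Y Z); split.
- by move=> e; exact: nev_cst.
- exact: nevw.
- exact: nevx.
- exact: nevy.
- exact: nevz.
Qed.

Definition nested_poly4 : poly4 k :=
  @Poly4 k {poly {poly {poly {poly k}}}} nc4 nwv nxv nyv nzv (@coef4 k)
    ncoef4D ncoef4_mon nR4_ind_supp nev4_ex
    (poly_ufd (poly_ufd (poly_ufd (poly_ufd (@field_ufd k))))).
End NestedFourVars.

(** [ev4] is by conversion an iterated [horner_morph]; two evaluations that agree on constants and
    variables are equal. The variables x2 and y2 stand for s and t. *)
Lemma macaulay_ideal_ev (k : fieldType) (F : nested_poly4 k) :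
  macaulay_ideal (F : R4 k) <->
  ev (R := nested_poly4 k) (@c2 k (nested_poly2 k))
     (x2 ^+ 4) (x2 ^+ 3 * y2) (x2 * y2 ^+ 3) (y2 ^+ 4) F = 0.
Proof.
rewrite /macaulay_ideal.
have -> : ev4 (F : R4 k) = nev (@nc2 k) (var_s k ^+ 4) (var_s k ^+ 3 * var_t k)
  (var_s k * var_t k ^+ 3) (var_t k ^+ 4) F by [].
set g := nev _ _ _ _ _; set f := ev _ _ _ _ _.
suff fg : f =1 (g : {rmorphism nested_poly4 k -> nested_poly2 k}) by rewrite fg.
apply: ev_unique.
- by move=> e; rewrite /f ev_c; symmetry; apply: nev_cst.
- by rewrite /f evw; symmetry; apply: nevw.
- by rewrite /f evx; symmetry; apply: nevx.
- by rewrite /f evy; symmetry; apply: nevy.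
- by rewrite /f evz; symmetry; apply: nevz.
Qed.

(** * Counting intersections of plane curves *)

Lemma gdeg2_leP (k : fieldType) (S : poly2 k) ox oy (F : S) n :
  reflect (forall a b, coef2 F a b != 0 -> (a * ox + b * oy <= n)%N)
          (gdeg (coact2 ox oy) F <= n)%N.
Proof.
have -> : (gdeg (coact2 ox oy) F <= n)%N = (size (coact2 ox oy F) <= n.+1)%N.
  by rewrite /gdeg; case: (size _).
apply: (iffP idP) => [/leq_sizeP h a b|h].
  apply: contraNT; rewrite -ltnNge => lt.
  have := coef2_coact2 ox oy (a * ox + b * oy) F a b; rewrite eqxx => <-.
  by rewrite h // coef2_0.
apply/leq_sizeP => j lt; apply: coef2_inj => a b.
rewrite coef2_coact2; case: eqP => // E; apply/eqP; apply: contraTT lt => /h.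
by rewrite E -leqNgt.
Qed.

Section PlaneBezout.
Variables (k : fieldType) (S : poly2 k).
Implicit Types F G P u v : S.
Local Notation theta := (@coact2 k S 1 1).

Definition deg2 F := gdeg theta F.

Lemma theta1 F : (theta F).[1] = F. Proof. exact: coact2_1. Qed.
Lemma thetaK F n : homog theta n (theta F)`_n. Proof. exact: coact2K. Qed.
Lemma theta_eq0 F : (theta F == 0) = (F == 0). Proof. exact: tau_eq0 theta1 F. Qed.

Lemma deg2M F G : F != 0 -> G != 0 -> deg2 (F * G) = (deg2 F + deg2 G)%N.
Proof. exact: (gdegM theta1). Qed.

Lemma size_theta F : F != 0 -> size (theta F) = (deg2 F).+1.
Proof. by move=> F0; rewrite /deg2 /gdeg prednK // size_poly_gt0 theta_eq0. Qed.

Lemma deg2_leP F n :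
  reflect (forall a b, coef2 F a b != 0 -> (a + b <= n)%N) (deg2 F <= n)%N.
Proof.
by apply: (iffP (gdeg2_leP 1 1 F n)) => h a b /h; rewrite !muln1.
Qed.

Lemma coef2_sum I (r : seq I) (p : pred I) (f : I -> S) a b :
  coef2 (\sum_(i <- r | p i) f i) a b = \sum_(i <- r | p i) coef2 (f i) a b.
Proof.
by elim/big_rec2: _ => [|i x y _ <-]; rewrite ?coef2_0 ?coef2D.
Qed.

Lemma coef2Z e F a b : coef2 (c2 e * F) a b = e * coef2 F a b.
Proof.
apply: (mon2_ind (P := fun F => coef2 (c2 e * F) a b = e * coef2 F a b)).
- by rewrite mulr0 coef2_0 mulr0.
- by move=> G H hG hH; rewrite mulrDr !coef2D hG hH mulrDr.
move=> a' b' _; have -> f : c2 e * mon2 f a' b' = mon2 (e * f) a' b' :> S.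
  by rewrite /mon2 rmorphM !mulrA.
by rewrite !coef2_mon2; case: ifP; rewrite ?mulr0.
Qed.

(** * Macaulay matrices in bounded degree *)

Definition monomials_le n := {p : 'I_n.+1 * 'I_n.+1 | (p.1 + p.2 <= n)%N}.
Definition dim_le n := #|{: monomials_le n}|.

Lemma dim_leE n : (dim_le n * 2 = n.+1 * n.+2)%N.
Proof.
have -> : dim_le n = (\sum_(i < n.+1) (n.+1 - i))%N.
  rewrite /dim_le card_sig -sum1_card.
  rewrite (eq_bigl (fun p : 'I_n.+1 * 'I_n.+1 => (fun i j => (i + j <= n)%N) p.1 p.2)) //.
  rewrite -(pair_big_dep xpredT (fun i j : 'I_n.+1 => (i + j <= n)%N) (fun _ _ => 1%N)) /=.
  apply: eq_bigr => i _; rewrite sum1_card.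
  have le : (n.+1 - i <= n.+1)%N by rewrite leq_subr.
  rewrite -[RHS]card_ord -(card_image (f := widen_ord le)); last first.
    by move=> x y /(congr1 val) /= h; apply: val_inj.
  apply: eq_card => j; apply/idP/mapP => [h|[x _ ->]].
    have lt : (j < n.+1 - i)%N by rewrite ltn_subRL ltnS.
    by exists (Ordinal lt); rewrite ?mem_enum //; apply: val_inj.
  by have := ltn_ord x; rewrite ltn_subRL ltnS.
elim: n => [|n IH]; first by rewrite big_ord1.
rewrite big_ord_recl subn0 (eq_bigr (fun i : 'I_n.+1 => (n.+1 - i)%N)); first by rewrite mulnDl IH; nia.
by move=> i _; rewrite /= /bump /= add1n subSS.
Qed.

(** The Euler characteristic of the Koszul complex of two polynomials of degrees a and b, truncated
    at degree n, is a b. *)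
Lemma dim_le_bezout n a b : (a + b <= n)%N ->
  (dim_le n + dim_le (n - a - b) = a * b + dim_le (n - a) + dim_le (n - b))%N.
Proof.
move=> h; have := dim_leE n; have := dim_leE (n - a); have := dim_leE (n - b); have := dim_leE (n - a - b).
have [m ->] : exists m, n = (m + a + b)%N by exists (n - (a + b))%N; lia.
have -> : (m + a + b - a - b = m)%N by lia.
have -> : (m + a + b - a = m + b)%N by lia.
have -> : (m + a + b - b = m + a)%N by lia.
by nia.
Qed.

Definition pw n (i : 'I_(dim_le n)) : nat * nat :=
  ((val (val (enum_val i)).1), (val (val (enum_val i)).2)).

Lemma pw_inj n : injective (@pw n).
Proof.
move=> i j [h1 h2]; apply: enum_val_inj; apply: val_inj.
rewrite [LHS]surjective_pairing [RHS]surjective_pairing.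
by congr (_, _); apply: val_inj.
Qed.

Lemma pw_le n i : ((@pw n i).1 + (@pw n i).2 <= n)%N.
Proof. exact: (valP (enum_val i)). Qed.

Lemma pw_surj n a b : (a + b <= n)%N -> exists i, @pw n i = (a, b).
Proof.
move=> h; have la : (a < n.+1)%N by rewrite ltnS (leq_trans _ h) ?leq_addr.
have lb : (b < n.+1)%N by rewrite ltnS (leq_trans _ h) ?leq_addl.
pose q : monomials_le n := exist _ (Ordinal la, Ordinal lb) h.
by exists (enum_rank q); rewrite /pw enum_rankK.
Qed.

Definition enc n (v : 'rV[k]_(dim_le n)) : S := \sum_i mon2 (v 0 i) (pw i).1 (pw i).2.
(** Monomials of degree above [n] are discarded, so [enc] recovers [F] only in degree at most
    [n]. *)
Definition dec n F : 'rV[k]_(dim_le n) := \row_i coef2 F (pw i).1 (pw i).2.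

Lemma decD n F G : dec n (F + G) = dec n F + dec n G.
Proof. by apply/rowP => i; rewrite !mxE coef2D. Qed.
Lemma decZ n e F : dec n (c2 e * F) = e *: dec n F.
Proof. by apply/rowP => i; rewrite !mxE coef2Z. Qed.
Lemma dec0 n : dec n 0 = 0.
Proof. by apply/rowP => i; rewrite !mxE coef2_0. Qed.
Lemma decN n F : dec n (- F) = - dec n F.
Proof. by apply/eqP; rewrite -addr_eq0 -decD addNr dec0. Qed.
Lemma dec_sum n I (r : seq I) (f : I -> S) :
  dec n (\sum_(i <- r) f i) = \sum_(i <- r) dec n (f i).
Proof. by elim/big_rec2: _ => [|i x y _ <-]; rewrite ?dec0 ?decD. Qed.

Lemma encD n (u v : 'rV_(dim_le n)) : enc (u + v) = enc u + enc v.
Proof.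
rewrite /enc -big_split; apply: eq_bigr => i _.
by rewrite mxE /mon2 rmorphD !mulrDl.
Qed.
Lemma encZ n e (v : 'rV_(dim_le n)) : enc (e *: v) = c2 e * enc v.
Proof.
rewrite /enc mulr_sumr; apply: eq_bigr => i _.
by rewrite mxE /mon2 rmorphM !mulrA.
Qed.
Lemma enc0 n : enc (0 : 'rV_(dim_le n)) = 0.
Proof. by rewrite -(scale0r (0 : 'rV_(dim_le n))) encZ rmorph0 mul0r. Qed.
Lemma enc_sum n I (r : seq I) (f : I -> 'rV_(dim_le n)) :
  enc (\sum_(i <- r) f i) = \sum_(i <- r) enc (f i).
Proof. by elim/big_rec2: _ => [|i x y _ <-]; rewrite ?enc0 ?encD. Qed.

Lemma encK n : cancel (@enc n) (dec n).
Proof.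
move=> v; apply/rowP => i; rewrite mxE /enc coef2_sum (bigD1 i) // big1.
  by rewrite coef2_mon2 !eqxx /= addr0.
move=> j ji; rewrite coef2_mon2; case: ifP => // /andP[/eqP h1 /eqP h2].
by case/eqP: ji; apply: pw_inj; rewrite [LHS]surjective_pairing -h1 -h2 -surjective_pairing.
Qed.

Lemma deg_enc n (v : 'rV_(dim_le n)) : (deg2 (enc v) <= n)%N.
Proof.
apply/deg2_leP => a b; apply: contraNT => h; rewrite /enc coef2_sum big1 // => i _.
rewrite coef2_mon2; case: ifP => // /andP[/eqP h1 /eqP h2].
by case/negP: h; rewrite h1 h2 pw_le.
Qed.

Lemma decK n F : (deg2 F <= n)%N -> enc (dec n F) = F.
Proof.
move=> /deg2_leP h; apply/eqP; rewrite -subr_eq0; apply/eqP/coef2_inj => a b.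
have -> : enc (dec n F) - F = enc (dec n F) + c2 (-1) * F by rewrite rmorphN1 mulN1r.
rewrite coef2D coef2Z mulN1r /enc coef2_sum.
have [le|lt] := leqP (a + b) n; last first.
  rewrite big1 => [|i _].
    apply/eqP; rewrite add0r oppr_eq0; apply: contraTT lt => /h.
    by rewrite -leqNgt.
  rewrite coef2_mon2; case: ifP => // /andP[/eqP h1 /eqP h2].
  by move: lt; rewrite h1 h2 ltnNge pw_le.
have [i pE] := pw_surj le; rewrite (bigD1 i) // big1 => [|j ji].
  by rewrite coef2_mon2 mxE pE !eqxx /= addr0 subrr.
rewrite coef2_mon2; case: ifP => // /andP[/eqP h1 /eqP h2].
by case/eqP: ji; apply: pw_inj; rewrite pE h1 h2.
Qed.

Definition mulM F m n : 'M[k]_(dim_le m, dim_le n) := \matrix_i dec n (F * enc (delta_mx 0 i)).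

Lemma mul_mulM F m n (v : 'rV_(dim_le m)) : v *m mulM F m n = dec n (F * enc v).
Proof.
rewrite {2}(row_sum_delta v) enc_sum mulr_sumr dec_sum mulmx_sum_row.
by apply: eq_bigr => i _; rewrite rowK encZ mulrCA decZ.
Qed.

Section Pair.
Variables F G : S.
Hypotheses (F0 : F != 0) (G0 : G != 0).
Local Notation a := (deg2 F).
Local Notation b := (deg2 G).

(** [sylv] is the Macaulay matrix of (u, v) -> u F + v G, and [syz] that of w -> (w G, - w F): the
    two maps of the truncated Koszul complex, acting on row vectors. *)
Definition sylv n : 'M[k]_(dim_le (n - a) + dim_le (n - b), dim_le n) :=
  col_mx (mulM F (n - a) n) (mulM G (n - b) n).
Definition syz n : 'M[k]_(dim_le (n - a - b), dim_le (n - a) + dim_le (n - b)) :=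
  row_mx (mulM G (n - a - b) (n - a)) (- mulM F (n - a - b) (n - b)).

Lemma deg_mul_enc H m n (v : 'rV_(dim_le m)) : H != 0 -> (m + deg2 H <= n)%N -> (deg2 (H * enc v) <= n)%N.
Proof.
move=> H0 le; have [->|v0] := eqVneq (enc v) 0.
  by rewrite mulr0 /deg2 /gdeg rmorph0 size_poly0.
by rewrite deg2M //; have := deg_enc v; lia.
Qed.

Lemma syz_mul n : (a + b <= n)%N -> syz n *m sylv n = 0.
Proof.
move=> le; apply/row_matrixP => i; rewrite row0 rowE mulmxA.
rewrite /syz /sylv mul_mx_row mul_row_col mulmxN mulNmx !mul_mulM.
rewrite !decK ?deg_mul_enc //; try lia.
by rewrite mulrCA subrr.
Qed.

Lemma rank_syz n : (a + b <= n)%N -> \rank (syz n) = dim_le (n - a - b).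
Proof.
move=> le; apply/eqP/row_freeP; apply/row_freeP/inj_row_free => v.
rewrite /syz mul_mx_row mul_mulM => /eqP; rewrite row_mx_eq0 => /andP[/eqP h _].
have : G * enc v = 0 by rewrite -[LHS](@decK (n - a)) ?h ?enc0 // deg_mul_enc //; lia.
move/eqP; rewrite mulf_eq0 (negbTE G0) /= => /eqP ev.
by rewrite -[v]encK ev dec0.
Qed.

(** The first hypothesis says that ideal elements of degree at most n already lie in the image of
    [sylv n]. The Koszul syzygies bound the rank of that image from above, so at least a b further
    vectors are needed to span. *)
Lemma bezout_lower r (e : 'I_r -> S) :
  (forall P u v, P = u * F + v * G -> exists u' v',
     [/\ P = u' * F + v' * G, (deg2 (u' * F) <= deg2 P)%N & (deg2 (v' * G) <= deg2 P)%N]) ->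
  (forall P, exists (c : 'I_r -> k) u v, P = \sum_i c2 (c i) * e i + u * F + v * G) ->
  (a * b <= r)%N.
Proof.
(* Large enough for the dimension count and for every [e i] to fit in degree n. *)
move=> div span; pose n := (a + b + \max_i deg2 (e i))%N.
have le : (a + b <= n)%N by rewrite /n leq_addr.
have dege i : (deg2 (e i) <= n)%N by rewrite /n; have := leq_bigmax (F := fun i => deg2 (e i)) i; lia.
pose E := \matrix_i dec n (e i).
have full : (1%:M <= E + sylv n)%MS.
  apply/row_subP => i; set x := row i _.
  have [c [u [v Px]]] := span (enc x).
  pose Q := u * F + v * G.
  have QE : Q = enc x - \sum_i c2 (c i) * e i by rewrite Px /Q; ring.
  have degQ : (deg2 Q <= n)%N.
    apply/deg2_leP => p q; have -> : Q = enc x + c2 (-1) * \sum_i c2 (c i) * e i.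
      by rewrite QE rmorphN1 mulN1r.
    rewrite coef2D coef2Z; apply: contraNT => h.
    have -> : coef2 (enc x) p q = 0.
      by apply/eqP; apply: contraNT h; apply: (deg2_leP _ _ (deg_enc x)).
    rewrite coef2_sum big1 ?mulr0 ?addr0 // => j _; rewrite coef2Z.
    suff -> : coef2 (e j) p q = 0 by rewrite mulr0.
    by apply/eqP; apply: contraNT h; apply: (deg2_leP _ _ (dege j)).
  have [u' [v' [QE' du dv]]] := div Q u v erefl.
  have xE : x = (\row_i c i) *m E + row_mx (dec _ u') (dec _ v') *m sylv n.
    have small H w m : H != 0 -> (deg2 (w * H) <= n)%N -> (n - deg2 H = m)%N ->
        (deg2 H <= n)%N -> (deg2 w <= m)%N.
      move=> H0; have [->|w0] := eqVneq w 0; last by rewrite deg2M //; lia.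
      by rewrite /deg2 /gdeg rmorph0 size_poly0.
    rewrite /sylv mul_row_col !mul_mulM !decK; first last.
    - by apply: (small F) => //; [exact: leq_trans du degQ | lia].
    - by apply: (small G) => //; [exact: leq_trans dv degQ | lia].
    rewrite -decD mulrC [G * _]mulrC -QE' QE.
    rewrite mulmx_sum_row decD encK decN dec_sum.
    rewrite [X in X + _](_ : _ = \sum_i dec n (c2 (c i) * e i)); first by rewrite addrC subrK.
    by apply: eq_bigr => j _; rewrite mxE rowK decZ.
  by rewrite xE addmx_sub_adds // submxMl.
have h1 := mxrankS full; rewrite mxrank1 in h1.
have h2 := leq_trans h1 (mxrank_adds_leqif E (sylv n)).1.
have h3 := rank_leq_row E.
have h4 := mulmx0_rank_max (syz_mul le); rewrite rank_syz // in h4.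
have := dim_le_bezout le; lia.
Qed.

(** Coprimality makes every element of the kernel of [sylv n] a Koszul syzygy, which bounds its rank
    from below; a basis of a complement of the image then has at most a b elements. *)
Lemma bezout_upper n : rel_prime F G -> (a + b <= n)%N ->
  exists r (e : 'I_r -> S), (r <= a * b)%N /\
  forall P, (deg2 P <= n)%N -> exists (c : 'I_r -> k) u v, P = \sum_i c2 (c i) * e i + u * F + v * G.
Proof.
move=> rp le; pose A := sylv n.
have ker : (kermx A <= syz n)%MS.
  apply/row_subP => i; set x := row i _.
  have xA : x *m A = 0 by apply/eqP; rewrite -sub_kermx row_sub.
  rewrite -(hsubmxK x) in xA *; move: xA; set u := lsubmx x; set v := rsubmx x.
  rewrite /A /sylv mul_row_col !mul_mulM -decD => h.
  have E : F * enc u + G * enc v = 0.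
    rewrite -[LHS](@decK n) ?h ?enc0 //.
    apply/deg2_leP => p q; rewrite coef2D; apply: contraNT => lt.
    have d1 : (deg2 (F * enc u) <= n)%N by rewrite deg_mul_enc //; lia.
    have d2 : (deg2 (G * enc v) <= n)%N by rewrite deg_mul_enc //; lia.
    have -> : coef2 (F * enc u) p q = 0.
      by apply/eqP; apply: contraNT lt; apply: (deg2_leP _ _ d1).
    have -> : coef2 (G * enc v) p q = 0.
      by apply/eqP; apply: contraNT lt; apply: (deg2_leP _ _ d2).
    by rewrite addr0.
  have [|c uE] := rp (enc u) (- enc v).
    by apply/eqP; rewrite -subr_eq0 mulNr opprK mulrC [_ * G]mulrC E.
  have vE : enc v = - (c * F).
    apply: (mulfI G0); apply/eqP; rewrite -subr_eq0 -[0]E uE.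
    by apply/eqP; ring.
  have dc : (deg2 c <= n - a - b)%N.
    have [->|c0] := eqVneq c 0; first by rewrite /deg2 /gdeg rmorph0 size_poly0.
    by have := deg_enc u; rewrite uE deg2M //; lia.
  suff -> : row_mx u v = dec _ c *m syz n by rewrite submxMl.
  rewrite /syz mul_mx_row mulmxN !mul_mulM decK // -[u in LHS]encK -[v in LHS]encK uE vE decN.
  by rewrite ![c * _]mulrC.
have h1 := mxrankS ker; rewrite mxrank_ker rank_syz // in h1.
have h2 := mxrank_compl A.
pose B := row_base (A^C)%MS.
exists (\rank (A^C)%MS), (fun i => enc (row i B)); split.
  have := dim_le_bezout le; have := rank_leq_col A; lia.
move=> P dP; have : (dec n P <= A^C + A)%MS.
  by rewrite submx_full // addsmxC addsmx_compl_full.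
rewrite -(adds_eqmx (eq_row_base (A^C)%MS) (eqmx_refl A)).
case/sub_addsmxP=> -[c d] /= E.
exists (fun i => c 0 i), (enc (lsubmx d)), (enc (rsubmx d)).
rewrite -[P](decK dP) E encD mulmx_sum_row enc_sum -addrA; congr (_ + _).
  by apply: eq_bigr => i _; rewrite encZ.
rewrite -{1}(hsubmxK d) /A /sylv mul_row_col encD !mul_mulM !decK ?deg_mul_enc //; try lia.
by rewrite mulrC [G * _]mulrC.
Qed.
End Pair.
End PlaneBezout.

Section Ideal2.
Variables (A : comNzRingType) (f g : A).
Local Notation I := (ideal2 f g).

Lemma ideal2_l : I f. Proof. by exists 1, 0; rewrite mul1r mul0r addr0. Qed.
Lemma ideal2_r : I g. Proof. by exists 0, 1; rewrite mul1r mul0r add0r. Qed.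
Lemma ideal2_0 : I 0. Proof. by exists 0, 0; rewrite !mul0r addr0. Qed.
Lemma ideal2D a b : I a -> I b -> I (a + b).
Proof. by case=> x [y ->] [z [t ->]]; exists (x + z), (y + t); ring. Qed.
Lemma ideal2M a b : I b -> I (a * b).
Proof. by case=> x [y ->]; exists (a * x), (a * y); ring. Qed.
Lemma ideal2_sum (T : Type) (r : seq T) (h : T -> A) : (forall i, I (h i)) -> I (\sum_(i <- r) h i).
Proof. by move=> H; elim/big_ind: _ => //; [exact: ideal2_0|exact: ideal2D]. Qed.
End Ideal2.

(** * Top forms and Bezout's inequality in the plane *)

Section Plane.
Variables (k : fieldType) (S : poly2 k).
Implicit Types F G P u v d : S.
Local Notation theta := (@coact2 k S 1 1).

Lemma c2_unit (e : k) : e != 0 -> (c2 e : S) \is a GRing.unit.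
Proof. by move=> e0; apply: rmorph_unit; rewrite unitfE. Qed.

Lemma const_unit d : d != 0 -> (forall a b, coef2 d a b != 0 -> a = 0%N /\ b = 0%N) ->
  d \is a GRing.unit.
Proof.
move=> d0 h; have dE : d = c2 (coef2 d 0 0).
  have : (deg2 d <= 0)%N by apply/deg2_leP => a b /h[-> ->].
  move=> /decK <-; set v := dec _ _.
  have [i pE] := @pw_surj 0 0 0 isT.
  have uni j : j = i.
    apply: pw_inj; rewrite pE; have := pw_le j; case: (pw j) => a b /=.
    by rewrite leqn0 addn_eq0 => /andP[/eqP-> /eqP->].
  rewrite /enc (bigD1 i) // big1; last by move=> j /eqP; case; apply: uni.
  by rewrite pE /= addr0 coef2_mon2 /mon2 !expr0 !mulr1.
rewrite dE; apply: c2_unit; apply: contraNneq d0 => h0.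
by rewrite dE h0 rmorph0.
Qed.

Lemma mon2_1 a b : mon2 1 a b = x2 ^+ a * y2 ^+ b :> S.
Proof. by rewrite /mon2 rmorph1 mul1r. Qed.

Lemma x2X_neq0 n : x2 ^+ n != 0 :> S.
Proof.
apply/eqP => h; have := coef2_mon2 (k := k) S 1 n 0 n 0.
by rewrite mon2_1 expr0 mulr1 h coef2_0 !eqxx /= => /esym/eqP; rewrite oner_eq0.
Qed.
Lemma y2X_neq0 n : y2 ^+ n != 0 :> S.
Proof.
apply/eqP => h; have := coef2_mon2 (k := k) S 1 0 n 0 n.
by rewrite mon2_1 expr0 mul1r h coef2_0 !eqxx /= => /esym/eqP; rewrite oner_eq0.
Qed.

Lemma gdeg_divides ox oy d F : divides d F -> F != 0 ->
  (gdeg (@coact2 k S ox oy) d <= gdeg (@coact2 k S ox oy) F)%N.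
Proof.
case=> q ->; rewrite mulf_eq0 negb_or => /andP[q0 d0].
by rewrite gdegM ?leq_addl //; apply: coact2_1.
Qed.

(** A divisor of a power of x has degree 0 in y, and a divisor of a power of y has degree 0 in x;
    the weights (0, 1) and (1, 0) measure these degrees. *)
Lemma divides_xy_unit d N M :
  divides d (x2 ^+ N) -> divides d (y2 ^+ M) -> d \is a GRing.unit.
Proof.
move=> dx dy; have d0 : d != 0.
  by case: dx => q E; apply: contraNneq (x2X_neq0 N) => h; rewrite E h mulr0.
have gx : gdeg (@coact2 k S 0 1) d = 0%N.
  apply/eqP; rewrite -leqn0; apply: leq_trans (gdeg_divides _ _ dx (x2X_neq0 N)) _.
  apply/gdeg2_leP => a b; rewrite -[x2 ^+ N]mulr1 -(expr0 y2) -mon2_1 coef2_mon2.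
  by case: ifP => [/andP[_ /eqP->]|]; rewrite ?eqxx // muln0.
have gy : gdeg (@coact2 k S 1 0) d = 0%N.
  apply/eqP; rewrite -leqn0; apply: leq_trans (gdeg_divides _ _ dy (y2X_neq0 M)) _.
  apply/gdeg2_leP => a b; rewrite -[y2 ^+ M]mul1r -(expr0 x2) -mon2_1 coef2_mon2.
  by case: ifP => [/andP[/eqP-> _]|]; rewrite ?eqxx // muln0.
apply: const_unit => // a b cn; split.
  have /gdeg2_leP/(_ a b cn) : (gdeg (@coact2 k S 1 0) d <= 0)%N by rewrite gy.
  by rewrite muln1 muln0 addn0 leqn0 => /eqP.
have /gdeg2_leP/(_ a b cn) : (gdeg (@coact2 k S 0 1) d <= 0)%N by rewrite gx.
by rewrite muln1 muln0 add0n leqn0 => /eqP.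
Qed.

Lemma rel_prime_xy F G N M : F != 0 -> G != 0 ->
  ideal2 F G (x2 ^+ N) -> ideal2 F G (y2 ^+ M) -> rel_prime F G.
Proof.
move=> F0 G0 Ix Iy; have [d [F' [G' [FE GE rp]]]] := rel_prime_gcd (@ufd2 k S) F0 G0.
have dI P : ideal2 F G P -> divides d P.
  by case=> a [b ->]; exists (a * F' + b * G'); rewrite FE GE; ring.
have dU : d \is a GRing.unit by apply: divides_xy_unit; apply: dI; [exact: Ix|exact: Iy].
move=> a b; rewrite FE GE => E; have [|c ->] := rp a b.
  by apply: (mulrI dU); rewrite mulrCA E mulrCA.
by exists (c / d); rewrite mulrA divrK.
Qed.

Lemma size_sub_lt (A : nzRingType) (p q : {poly A}) :
  p != 0 -> size q = size p -> lead_coef q = lead_coef p -> (size (p - q)%R < size p)%N.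
Proof.
move=> p0 sq lq; have sp : (0 < size p)%N by rewrite size_poly_gt0.
rewrite -(prednK sp) ltnS; apply/leq_sizeP => j hj; rewrite coefB.
have [->|ne] := eqVneq j (size p).-1.
  by move: lq; rewrite /lead_coef sq => ->; rewrite subrr.
have lt : (size p <= j)%N by rewrite -(prednK sp) ltn_neqAle eq_sym ne hj.
by rewrite !nth_default ?subrr // sq.
Qed.

(** If u F has larger degree than P, the top forms of u F and v G cancel. By coprimality this
    cancellation is a Koszul relation, and subtracting the corresponding multiple of (G, - F) from
    (u, v) lowers the degree of u F. *)
Lemma top_division F G : F != 0 -> G != 0 ->
  rel_prime (lead_coef (theta F)) (lead_coef (theta G)) ->
  forall P u v, P = u * F + v * G -> exists u' v',
   [/\ P = u' * F + v' * G, (deg2 (u' * F) <= deg2 P)%N & (deg2 (v' * G) <= deg2 P)%N].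
Proof.
move=> F0 G0 rp P u; have [n] := ubnP (size (theta (u * F))).
elim: n u => // n IH u ltn v PE.
have vGE : v * G = P - u * F by rewrite PE; ring.
have [le|lt] := leqP (size (theta (u * F))) (size (theta P)).
  exists u, v; split=> //; rewrite /deg2 /gdeg -!subn1 leq_sub2r //.
  rewrite vGE rmorphB; apply: leq_trans (size_polyD _ _) _.
  by rewrite size_polyN geq_max leqnn le.
have uF0 : u * F != 0 by rewrite -theta_eq0 -size_poly_gt0 (leq_ltn_trans _ lt).
have u0 : u != 0 by apply: contraNneq uF0 => ->; rewrite mul0r.
pose s := (size (theta (u * F))).-1.
have sE : size (theta (u * F)) = s.+1 by rewrite /s prednK // size_poly_gt0 theta_eq0.
have Ps : (theta P)`_s = 0 by apply/leq_sizeP: (leqnn s); rewrite -ltnS -sE.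
have vGs : (theta (v * G))`_s = - lead_coef (theta (u * F)).
  by rewrite vGE rmorphB coefB Ps sub0r /lead_coef sE.
have lc0 : lead_coef (theta (u * F)) != 0 by rewrite lead_coef_eq0 theta_eq0.
have vGsz : size (theta (v * G)) = s.+1.
  apply/eqP; rewrite eqn_leq; apply/andP; split.
    rewrite vGE rmorphB; apply: leq_trans (size_polyD _ _) _.
    by rewrite size_polyN geq_max sE leqnn andbT -sE ltnW.
  rewrite ltnNge; apply/negP => h; move: vGs; rewrite nth_default // => /esym/eqP.
  by rewrite oppr_eq0 (negbTE lc0).
have vG0 : v * G != 0 by rewrite -theta_eq0 -size_poly_gt0 vGsz.
have lE : lead_coef (theta u) * lead_coef (theta F) = - lead_coef (theta v) * lead_coef (theta G).
  rewrite -lead_coefM -rmorphM mulNr -lead_coefM -rmorphM.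
  by apply/eqP; rewrite -eqr_oppLR -vGs /lead_coef vGsz.
have [c cE] := rp _ _ lE.
have lcu0 : lead_coef (theta u) != 0 by rewrite lead_coef_eq0 theta_eq0.
have hu : homog theta (deg2 u) (lead_coef (theta u)) by exact: thetaK.
have hG : homog theta (deg2 G) (lead_coef (theta G)) by exact: thetaK.
(* Being a factor of a form, [c] is homogeneous; so [c * G] has the same degree and top form as
   [u]. *)
have [e he] : exists e, homog theta e c.
  by apply: (@homog_factor _ theta (@theta1 k S) (deg2 u) c (lead_coef (theta G))); rewrite -cE.
have eE : (e + deg2 G = deg2 u)%N.
  rewrite -(homog_gdeg lcu0 hu) {1}cE; apply/esym; apply: homog_gdeg; rewrite -?cE //.
  by rewrite cE; apply: homogM.
have c0 : c != 0 by apply: contraNneq lcu0 => h; rewrite cE h mul0r.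
have cG0 : c * G != 0 by rewrite mulf_neq0.
have lt' : (size (theta (u - c * G)%R) < size (theta u))%N.
  rewrite rmorphB; apply: size_sub_lt; rewrite ?theta_eq0 //.
    by rewrite !size_theta // deg2M // (homog_gdeg c0 he : deg2 c = e) eE.
  by rewrite rmorphM lead_coefM he lead_coefZ lead_coefXn mulr1 -cE.
have [||u' [v' H]] := IH (u - c * G) _ (v + c * F); last by exists u', v'.
  rewrite -ltnS; apply: leq_trans ltn; rewrite ltnS.
  have [->|w0] := eqVneq (u - c * G) 0.
    by rewrite mul0r rmorph0 size_poly0 sE.
  move: lt'; rewrite !size_theta ?mulf_neq0 // !deg2M // !ltnS ltn_add2r //.
by rewrite PE; ring.
Qed.

(** The two ideal memberships say that the curves have no common point on the line at infinity, so
    no intersection is lost there. *)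
Lemma bezout_tops F G N M r (e : 'I_r -> S) : F != 0 -> G != 0 ->
  ideal2 (lead_coef (theta F)) (lead_coef (theta G)) (x2 ^+ N) ->
  ideal2 (lead_coef (theta F)) (lead_coef (theta G)) (y2 ^+ M) ->
  (forall P, exists (c : 'I_r -> k) u v, P = \sum_i c2 (c i) * e i + u * F + v * G) ->
  (deg2 F * deg2 G <= r)%N.
Proof.
move=> F0 G0 Ix Iy; apply: bezout_lower => //; apply: top_division => //.
by apply: rel_prime_xy Ix Iy; rewrite lead_coef_eq0 theta_eq0.
Qed.

Lemma span_x (x : S) n a : exists (c : 'I_(4 * n).+1 -> k) A,
  x ^+ a = \sum_i c2 (c i) * x ^+ i + A * (x ^+ 4 - 1) ^+ n.
Proof.
pose h : {rmorphism {poly k} -> S} := horner_morph (comm_rm (@c2 k S) x).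
pose q : {poly k} := ('X^4 - 1) ^+ n.
have hX : h 'X = x by exact: (horner_morphX (comm_rm (@c2 k S) x)).
have hC c : h c%:P = c2 c by exact: (horner_morphC (comm_rm (@c2 k S) x)).
have s4 : size ('X^4 - 1 : {poly k}) = 5.
  by rewrite size_polyDl size_polyXn // size_polyN size_poly1.
have q0 : q != 0 by rewrite expf_neq0 // -size_poly_eq0 s4.
have sq : size q = (4 * n).+1.
  by rewrite -[size q]prednK ?size_poly_gt0 // /q size_exp s4.
exists (fun i => ('X^a %% q)`_i), (h ('X^a %/ q)).
have -> : x ^+ a = h 'X^a by rewrite rmorphXn hX.
rewrite {1}(divp_eq 'X^a q) rmorphD rmorphM addrC; congr (_ + _ * _); last first.
  by rewrite /q rmorphXn rmorphB rmorphXn rmorph1 hX.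
rewrite -[in LHS](coefK ('X^a %% q)) poly_def rmorph_sum.
have le : (size ('X^a %% q)%R <= (4 * n).+1)%N.
  by rewrite -sq ltnW // ltn_modp.
rewrite (big_ord_widen _ (fun i => h ((('X^a %% q)`_i) *: 'X^i)) le) big_mkcond.
apply: eq_bigr => i _; case: ltnP => [_|h0]; first by rewrite -mul_polyC rmorphM hC rmorphXn hX.
by rewrite nth_default // rmorph0 mul0r.
Qed.

Lemma deg2D F G n : (deg2 F <= n)%N -> (deg2 G <= n)%N -> (deg2 (F + G) <= n)%N.
Proof.
move=> /deg2_leP hF /deg2_leP hG; apply/deg2_leP => a b; rewrite coef2D.
have [h|/hF //] := eqVneq (coef2 F a b) 0; rewrite h add0r; exact: hG.
Qed.

Lemma deg20 : deg2 (0 : S) = 0%N.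
Proof. by rewrite /deg2 /gdeg rmorph0 size_poly0. Qed.

Lemma deg2_sum (I : Type) (r : seq I) (f : I -> S) n :
  (forall i, (deg2 (f i) <= n)%N) -> (deg2 (\sum_(i <- r) f i) <= n)%N.
Proof. by move=> H; elim/big_ind: _ => [|x y|i _]; [rewrite deg20|exact: deg2D|exact: H]. Qed.

Lemma deg2_mon e a b : (deg2 (mon2 e a b : S) <= a + b)%N.
Proof.
by apply/deg2_leP => a' b'; rewrite coef2_mon2; case: ifP => [/andP[/eqP-> /eqP->]|]; rewrite ?eqxx.
Qed.

(** Division by powers of x^4 - 1 and y^4 - 1, one variable at a time; the bound [N] is uniform in
    [s]. *)
Lemma span_finite n m : exists N, forall s : S, exists s',
  (deg2 s' <= N)%N /\ ideal2 ((x2 ^+ 4 - 1) ^+ n) ((y2 ^+ 4 - 1) ^+ m) (s - s').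
Proof.
exists ((4 * n).+1 + (4 * m).+1)%N => s; set N := addn _ _.
set I := ideal2 _ _.
apply: (mon2_ind (P := fun s => exists s', (deg2 s' <= N)%N /\ I (s - s'))).
- by exists 0; rewrite deg20 subrr; split=> //; apply: ideal2_0.
- move=> G H [G' [dG IG]] [H' [dH IH]]; exists (G' + H'); split; first exact: deg2D.
  by rewrite opprD addrACA; apply: ideal2D.
move=> a b _; have [c [A EA]] := span_x (x2 : S) n a; have [d [B EB]] := span_x (y2 : S) m b.
set e := coef2 _ _ _.
exists (\sum_i \sum_j mon2 (e * c i * d j) i j); split.
  apply: deg2_sum => i; apply: deg2_sum => j; apply: leq_trans (deg2_mon _ _ _) _.
  by apply: leq_add; apply: ltnW.
have -> : \sum_i \sum_j mon2 (e * c i * d j) i j =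
    c2 e * (\sum_i c2 (c i) * x2 ^+ i) * (\sum_i c2 (d i) * y2 ^+ i) :> S.
  rewrite [c2 e * _]mulr_sumr mulr_suml; apply: eq_bigr => i _.
  rewrite mulr_sumr; apply: eq_bigr => j _.
  by rewrite /mon2 !rmorphM /=; ring.
exists (c2 e * A * y2 ^+ b), (c2 e * (\sum_i c2 (c i) * x2 ^+ i) * B).
by rewrite /mon2 EA EB; ring.
Qed.
End Plane.

(** * Specialization of a one-parameter family *)

Section Specialization.
Variables (k : closedFieldType) (S : poly2 k) (F G : {poly S}).

(** The saturation by T, which removes the T-torsion and makes the family flat over k[T]. *)
Definition satI (P : {poly S}) := exists r : nat, ideal2 F G ('X^r * P).
(** The fibre of the saturation at T = 0, that is the ideal of the limit. *)
Definition initI (s : S) := exists2 P, satI P & P`_0 = s.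

Lemma satI0 : satI 0.
Proof. by exists 0%N; rewrite mulr0; apply: ideal2_0. Qed.
Lemma satID P Q : satI P -> satI Q -> satI (P + Q).
Proof.
case=> r hP [s hQ]; exists (r + s)%N; rewrite mulrDr exprD; apply: ideal2D.
  by rewrite -mulrA mulrCA; apply: ideal2M.
by rewrite -mulrA; apply: ideal2M.
Qed.
Lemma satIM A P : satI P -> satI (A * P).
Proof. by case=> r hP; exists r; rewrite mulrCA; apply: ideal2M. Qed.
Lemma satIN P : satI P -> satI (- P).
Proof. by rewrite -mulN1r; apply: satIM. Qed.
Lemma satI_sum (T : Type) (r : seq T) (h : T -> {poly S}) :
  (forall i, satI (h i)) -> satI (\sum_(i <- r) h i).
Proof. by move=> H; elim/big_ind: _ => //; [exact: satI0|exact: satID]. Qed.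

Lemma initID a b : initI a -> initI b -> initI (a + b).
Proof. by case=> P hP <- [Q hQ <-]; exists (P + Q); rewrite ?coefD //; apply: satID. Qed.
Lemma initIM a b : initI b -> initI (a * b).
Proof. by case=> P hP <-; exists (a%:P * P); rewrite ?coefCM //; apply: satIM. Qed.

Lemma satI_horner P (l : k) : l != 0 -> satI P ->
  ideal2 F.[c2 l] G.[c2 l] P.[c2 l].
Proof.
move=> l0 [r [A [B E]]].
have := congr1 (fun Q => Q.[c2 l]) E; rewrite /= hornerD !hornerM hornerXn => E'.
have lU : (c2 l ^+ r : S) \is a GRing.unit by rewrite unitrX // c2_unit.
exists (A.[c2 l] / c2 l ^+ r), (B.[c2 l] / c2 l ^+ r).
apply: (mulrI lU); rewrite E' mulrDr.
by congr (_ + _); rewrite mulrA mulrCA mulrV // mulr1.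
Qed.

(** Elements of the saturation that are constant in T make the quotient a finite k[T]-module. They
    will be powers of x^4 - 1 and y^4 - 1. *)
Variables (q1 q2 : S) (N : nat).
Hypothesis sq1 : satI q1%:P.
Hypothesis sq2 : satI q2%:P.
Hypothesis fin : forall s : S, exists s', (deg2 s' <= N)%N /\ ideal2 q1 q2 (s - s').
Variables (r : nat) (e' : 'I_r -> S).
Hypothesis span0 : forall s : S, (deg2 s <= N)%N ->
  exists c : 'I_r -> k, initI (s - \sum_i c2 (c i) * e' i).

Local Notation lift := (map_poly (@c2 k S)).
Let e (i : 'I_(dim_le N)) : S := mon2 1 (pw i).1 (pw i).2.

Let decE s : (deg2 s <= N)%N -> s = \sum_i c2 (dec N s 0 i) * e i.
Proof.
move=> h; rewrite -{1}(decK h); apply: eq_bigr => i _.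
by rewrite /e /mon2 rmorph1 mul1r mulrA.
Qed.

Let q_satI s : ideal2 q1 q2 s -> satI s%:P.
Proof.
by case=> a [b ->]; rewrite rmorphD !rmorphM; apply: satID; apply: satIM.
Qed.

(** The coefficients in T are reduced to degree at most [N] one after another. *)
Let lift_span (Q : {poly S}) : exists b : 'I_(dim_le N) -> {poly k},
  satI (Q - \sum_i lift (b i) * (e i)%:P).
Proof.
elim/poly_ind: Q => [|Q s [b IH]].
  by exists (fun=> 0); rewrite big1 ?subrr; [apply: satI0|move=> i _; rewrite rmorph0 mul0r].
have [s' [ds' Is]] := fin s.
exists (fun i => b i * 'X + (dec N s' 0 i)%:P).
have -> : Q * 'X + s%:P - \sum_i lift (b i * 'X + (dec N s' 0 i)%:P) * (e i)%:P =
   'X * (Q - \sum_i lift (b i) * (e i)%:P) + (s - s')%:P.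
  have -> : \sum_i lift (b i * 'X + (dec N s' 0 i)%:P) * (e i)%:P =
     'X * (\sum_i lift (b i) * (e i)%:P) + s'%:P.
    rewrite [in RHS](decE ds') rmorph_sum mulr_sumr -big_split; apply: eq_bigr => i _.
    rewrite rmorphD rmorphM /= map_polyX map_polyC mulrDl; congr (_ + _); last by rewrite -polyCM.
    by rewrite mulrAC mulrC.
  by rewrite polyCB; ring.
apply: satID; [exact: satIM|exact: q_satI].
Qed.

(* Nakayama's lemma for the torsion-free k[T]-module {poly S} / satI, made
   explicit: det (1 + T B) does not vanish at T = 0. *)
Lemma span_specialize : exists2 l : k, l != 0 &
  forall s : S, exists (c : 'I_r -> k) u v,
    s = \sum_i c2 (c i) * e' i + u * F.[c2 l] + v * G.[c2 l].
Proof.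
(* Modulo T each [e j] is a combination of the [e'], and the error is T times a combination of the
   [e i]: modulo the saturation, (1 + T B) e = A e'. *)
have step (j : 'I_(dim_le N)) : exists ab : ('I_r -> k) * ('I_(dim_le N) -> {poly k}),
  satI ((e j)%:P + 'X * (\sum_i lift (ab.2 i) * (e i)%:P) - \sum_i lift (ab.1 i)%:P * (e' i)%:P).
  have [|a [P sP P0]] := span0 (s := e j).
    by apply: (@leq_trans ((pw j).1 + (pw j).2)); [exact: deg2_mon|exact: pw_le].
  have [b hb] := lift_span (drop_poly 1 P).
  exists (a, b) => /=.
  have PE : P = (P`_0)%:P + 'X * drop_poly 1 P.
    have := poly_take_drop 1 P; rewrite expr1 mulrC => {1}<-; congr (_ + _).
    by apply/polyP => i; rewrite coef_take_poly coefC; case: i.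
  have -> : (e j)%:P + 'X * (\sum_i lift (b i) * (e i)%:P) - \sum_i lift (a i)%:P * (e' i)%:P =
     P - 'X * (drop_poly 1 P - \sum_i lift (b i) * (e i)%:P).
    rewrite {1}PE P0 polyCB rmorph_sum /=.
    have -> : \sum_i lift (a i)%:P * (e' i)%:P = \sum_i (c2 (a i) * e' i)%:P.
      by apply: eq_bigr => i _; rewrite map_polyC rmorphM.
    by ring.
  by apply: satID => //; apply/satIN/satIM.
have [ab hab] := fin_all_exists step.
pose B : 'M[{poly k}]_(dim_le N) := \matrix_(i, j) (ab i).2 j.
pose M := 1%:M + 'X *: B.
have M0 : \det M != 0.
  apply/eqP => h; have := congr1 (horner_eval 0) h; rewrite -det_map_mx.
  have -> : map_mx (horner_eval 0) M = 1%:M.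
    apply/matrixP => i j; rewrite !mxE /horner_eval hornerD hornerM hornerX mul0r addr0.
    by rewrite -mulr_natl hornerM hornerC mulr1 -polyC_natr hornerC.
  by rewrite det1 /horner_eval horner0 => /eqP; rewrite oner_eq0.
(* [T * det M] is a nonzero polynomial; off its roots both T and det M specialize to units. *)
have [l] : exists l, ~~ root ('X * \det M) l.
  by apply/closed_nonrootP; rewrite mulf_neq0 ?polyX_eq0.
rewrite rootM negb_or rootX => /andP[l0 dl]; exists l => //.
pose A : 'M[{poly k}]_(dim_le N, r) := \matrix_(i, j) ((ab i).1 j)%:P.
have dlU : (c2 (\det M).[l] : S) \is a GRing.unit by apply: c2_unit.
have spanE j : exists c : 'I_r -> k,
    ideal2 F.[c2 l] G.[c2 l] (e j - \sum_i c2 (c i) * e' i).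
  have rel m : satI (\sum_i lift (M m i) * (e i)%:P - \sum_i lift (A m i) * (e' i)%:P).
    have := hab m; congr satI; congr (_ - _); last by apply: eq_bigr => i _; rewrite mxE.
    rewrite mulr_sumr -[(e m)%:P]mul1r.
    have -> : 1 * (e m)%:P = \sum_i lift (1%:M m i) * (e i)%:P.
      rewrite (bigD1 m) //= big1 => [|i im]; first by rewrite mxE eqxx rmorph1 addr0.
      by rewrite mxE eq_sym (negbTE im) rmorph0 mul0r.
    rewrite -big_split; apply: eq_bigr => i _.
    by rewrite /= [in RHS]mxE rmorphD mulrDl !mxE (rmorphM lift) /= map_polyX mulrA.
  (* Multiplication by the adjugate solves for [e j] up to the factor det M. *)
  have adj : satI (lift (\det M) * (e j)%:P - \sum_i lift ((\adj M *m A) j i) * (e' i)%:P).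
    have : satI (\sum_m lift (\adj M j m) *
             (\sum_i lift (M m i) * (e i)%:P - \sum_i lift (A m i) * (e' i)%:P)).
      by apply: satI_sum => m; apply: satIM.
    congr satI; under eq_bigr do rewrite mulrBr !mulr_sumr.
    rewrite sumrB; congr (_ - _).
      rewrite exchange_big /=.
      transitivity (\sum_i lift ((\adj M *m M) j i) * (e i)%:P).
        apply: eq_bigr => i _; rewrite mxE rmorph_sum mulr_suml.
        by apply: eq_bigr => m _; rewrite (rmorphM lift) mulrA.
      rewrite mul_adj_mx (bigD1 j) //= big1 => [|i ij]; first by rewrite mxE eqxx mulr1n addr0.
      by rewrite mxE eq_sym (negbTE ij) mulr0n rmorph0 mul0r.
    rewrite exchange_big; apply: eq_bigr => i _ /=; rewrite mxE rmorph_sum mulr_suml.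
    by apply: eq_bigr => m _; rewrite (rmorphM lift) mulrA.
  have := satI_horner l0 adj; rewrite hornerD hornerN hornerM hornerC horner_map.
  move=> H; exists (fun i => ((\adj M *m A) j i).[l] / (\det M).[l]).
  have := ideal2M (c2 (\det M).[l])^-1 H; congr ideal2.
  rewrite mulrBr mulKr //; congr (_ - _).
  rewrite [(\sum_(i < r) _).[_]]horner_sum mulr_sumr; apply: eq_bigr => i _.
  by rewrite hornerM hornerC horner_map rmorphM rmorphV ?unitfE //= mulrCA mulrA.
have [c hc] := fin_all_exists spanE.
move=> s; have [s' [ds' Is]] := fin s.
exists (fun i => \sum_j dec N s' 0 j * c j i).
suff [u [v E]] : ideal2 F.[c2 l] G.[c2 l] (s - \sum_i c2 (\sum_j dec N s' 0 j * c j i) * e' i).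
  by exists u, v; rewrite -addrA -E addrC subrK.
have -> : s - \sum_i c2 (\sum_j dec N s' 0 j * c j i) * e' i =
   (s - s') + \sum_j c2 (dec N s' 0 j) * (e j - \sum_i c2 (c j i) * e' i).
  under [in RHS]eq_bigr do rewrite mulrBr mulr_sumr.
  rewrite sumrB -(decE ds') exchange_big /= addrA subrK; congr (_ - _).
  apply: eq_bigr => i _; rewrite rmorph_sum mulr_suml; apply: eq_bigr => j _.
  by rewrite rmorphM mulrA.
apply: ideal2D; last by apply: ideal2_sum => j; apply: ideal2M.
by have := satI_horner l0 (q_satI Is); rewrite hornerC.
Qed.
End Specialization.

(** * The trace argument *)

Lemma mxtrace_nilpotent (k : closedFieldType) n (M : 'M[k]_n) m : M ^+ m = 0 -> \tr M = 0.
Proof.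
move=> Mm; case: n M Mm => [|n] M Mm; first by rewrite /mxtrace big_ord0.
have [s cE] := closed_field_poly_normal (char_poly M).
rewrite (monicP (char_poly_monic M)) scale1r in cE.
have s0 a : a \in s -> a = 0.
  move=> /(_ : _ -> root (char_poly M) a); rewrite cE root_prod_XsubC => /(_ id).
  rewrite -root_prod_XsubC -cE -eigenvalue_root_char => /eigenvalueP[v vM v0].
  have vX j : v *m M ^+ j = a ^+ j *: v.
    elim: j => [|j IH]; first by rewrite expr0 mulmx1 scale1r.
    by rewrite exprS -mulmxE mulmxA vM -scalemxAl IH scalerA -exprS.
  have := vX m; rewrite Mm mulmx0 => /esym/eqP; rewrite scaler_eq0 (negbTE v0) orbF.
  by rewrite expf_eq0 => /andP[_ /eqP].
have cX : char_poly M = 'X^(size s).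
  rewrite cE; elim: s s0 {cE} => [|a s IH] s0; first by rewrite big_nil.
  rewrite big_cons IH => [|b bs]; last by apply: s0; rewrite inE bs orbT.
  by rewrite (s0 a (mem_head _ _)) subr0 -exprS.
have sz : size s = n.+1 by have := size_char_poly M; rewrite cX size_polyXn => -[].
have := @char_poly_trace _ _ M isT; rewrite cX sz coefXn /= ltn_eqF //.
by move/esym/eqP; rewrite oppr_eq0 => /eqP.
Qed.

Lemma top_form (k : fieldType) (S : poly2 k) (F : S) d u :
  u != 0 -> (deg2 F <= d)%N -> (coact2 1 1 F)`_d = u ->
  [/\ F != 0, deg2 F = d & lead_coef (coact2 1 1 F) = u].
Proof.
move=> u0 le uE; have F0 : F != 0.
  by apply: contraNneq u0 => F0; rewrite -uE F0 rmorph0 coef0.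
have sz := size_theta F0.
have dE : deg2 F = d.
  apply/eqP; rewrite eqn_leq le /= leqNgt; apply/negP => lt.
  by move: u0; rewrite -uE nth_default ?eqxx // sz.
by split=> //; rewrite /lead_coef sz dE.
Qed.

Section Trace.
Variables (k : closedFieldType) (S : poly2 k) (f g : S) (d1 d2 : nat).
Hypothesis hchar : [pchar k] =i pred0.
Hypotheses (d1_gt0 : (0 < d1)%N) (d2_gt0 : (0 < d2)%N).
Hypothesis f_top : coef2 f d1 0 != 0.
(** [(3 * b + c, b + 3 * c)] is the bidegree of x^b y^c. In a form of bidegree (3 d1, d1), setting w
    = z = 1 subtracts 4 from the first degree for each w and 4 from the second for each z. *)
Hypothesis f_supp : forall b c, coef2 f b c != 0 ->
  (b = d1 /\ c = 0%N) \/ (3 * b + c + 8 <= 3 * d1 /\ b + 3 * c <= d1)%N.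
Hypothesis g_top : coef2 g 0 d2 != 0.
Hypothesis g_supp : forall b c, coef2 g b c != 0 ->
  (b = 0%N /\ c = d2) \/ (b + 3 * c + 8 <= 3 * d2 /\ 3 * b + c <= d2)%N.
Local Notation I := (ideal2 f g).

Let N := #|{: 'I_d1 * 'I_d2}|.
Let m (i : 'I_N) : S := x2 ^+ (enum_val i).1 * y2 ^+ (enum_val i).2.

(** Reduction into the box i < d1, j < d2, with [Q] recording which exponents may appear. *)
Definition red (Q : nat -> nat -> Prop) (s : S) := exists2 c : 'I_N -> k,
  I (s - \sum_i c2 (c i) * m i) &
  forall i, c i != 0 -> Q (val (enum_val i).1) (val (enum_val i).2).

(** What at least one rewriting step guarantees: neither degree rises, and one of them falls by 8 or
    more. *)
Definition drop (b c i j : nat) :=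
  [/\ 3 * i + j <= 3 * b + c, i + 3 * j <= b + 3 * c &
      (3 * i + j + 8 <= 3 * b + c) || (i + 3 * j + 8 <= b + 3 * c)]%N.

Lemma red0 Q : red Q 0.
Proof.
exists (fun=> 0) => [|i]; last by rewrite eqxx.
by rewrite big1 ?subrr; [apply: ideal2_0|move=> i _; rewrite rmorph0 mul0r].
Qed.

Lemma redD Q s s' : red Q s -> red Q s' -> red Q (s + s').
Proof.
case=> c Ic Qc [c' Ic' Qc']; exists (fun i => c i + c' i).
  under eq_bigr do rewrite rmorphD mulrDl.
  by rewrite big_split opprD addrACA; apply: ideal2D.
by move=> i; have [->|/Qc //] := eqVneq (c i) 0; rewrite add0r => /Qc'.
Qed.

Lemma redZ Q e s : red Q s -> red Q (c2 e * s).
Proof.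
case=> c Ic Qc; exists (fun i => e * c i).
  under eq_bigr do rewrite rmorphM -mulrA.
  by rewrite -mulr_sumr -mulrBr; apply: ideal2M.
by move=> i; rewrite mulf_eq0 negb_or => /andP[_ /Qc].
Qed.

Lemma redI Q s s' : I (s - s') -> red Q s' -> red Q s.
Proof.
move=> Is [c Ic Qc]; exists c => //.
by rewrite -[s](subrK s') -addrA; apply: ideal2D.
Qed.

Lemma redS (Q Q' : nat -> nat -> Prop) s : (forall i j, Q i j -> Q' i j) -> red Q s -> red Q' s.
Proof. by move=> QQ [c Ic Qc]; exists c => // i /Qc/QQ. Qed.

Lemma tail_supp (F : S) b0 c0 b c :
  coef2 (F - mon2 (coef2 F b0 c0) b0 c0) b c != 0 ->
  coef2 F b c != 0 /\ ((b, c) != (b0, c0)).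
Proof.
have -> : F - mon2 (coef2 F b0 c0) b0 c0 = F + c2 (-1) * mon2 (coef2 F b0 c0) b0 c0.
  by rewrite rmorphN1 mulN1r.
rewrite coef2D coef2Z coef2_mon2 mulN1r xpair_eqE; case: andP => [[/eqP-> /eqP->]|_].
  by rewrite subrr eqxx.
by rewrite oppr0 addr0.
Qed.

(** Rewriting terminates on the total degree: adding the two support inequalities shows that every
    other term of [f] or [g] has total degree at least 2 below the pure power. A monomial already in
    the box gives the first alternative. *)
Lemma red_mon b c : red (fun i j => (i = b /\ j = c) \/ drop b c i j) (x2 ^+ b * y2 ^+ c).
Proof.
have [n] := ubnP (b + c); elim: n b c => // n IH b c ltn.
(* One rewriting by [F], solved for its monomial x^b0 y^c0 and multiplied by x^b1 y^c1. *)
have step (F : S) b0 c0 b1 c1 : I F -> coef2 F b0 c0 != 0 -> (b = b1 + b0)%N -> (c = c1 + c0)%N ->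
    (forall b' c', coef2 F b' c' != 0 -> (b', c') != (b0, c0) ->
       drop b c (b1 + b') (c1 + c') /\ (b' + c' < b0 + c0)%N) ->
    red (drop b c) (x2 ^+ b * y2 ^+ c).
  move=> IF F0 bE cE suppF; set a := coef2 F b0 c0 in F0.
  pose s' := c2 (- a^-1) * (x2 ^+ b1 * y2 ^+ c1 * (F - mon2 a b0 c0)).
  apply: (redI (s' := s')).
    have -> : x2 ^+ b * y2 ^+ c - s' = c2 a^-1 * (x2 ^+ b1 * y2 ^+ c1) * F.
      have ea : c2 a^-1 * c2 a = 1 :> S by rewrite -rmorphM mulVf // rmorph1.
      rewrite /s' /mon2 rmorphN bE cE !exprD -[X in X - _]mul1r -ea; ring.
    exact: ideal2M.
  apply: redZ.
  apply: (mon2_ind (P := fun G => red (drop b c) (x2 ^+ b1 * y2 ^+ c1 * G))).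
  - by rewrite mulr0; apply: red0.
  - by move=> G H hG hH; rewrite mulrDr; apply: redD.
  move=> b' c' /tail_supp[cn ne]; have [dr lt] := suppF _ _ cn ne.
  set e := coef2 _ _ _.
  have -> : x2 ^+ b1 * y2 ^+ c1 * mon2 e b' c' = c2 e * (x2 ^+ (b1 + b') * y2 ^+ (c1 + c')) :> S.
    by rewrite /mon2 !exprD; ring.
  apply: redZ; apply: redS (IH _ _ _); last by lia.
  move=> i j [[-> ->] //|]; case: dr => h1 h2 h3 [h4 h5 h6]; split; lia.
have [led|ltd] := leqP d1 b.
  apply: redS (step f d1 0%N (b - d1)%N c _ _ _ _ _) => //; first by right.
  - exact: ideal2_l.
  - by rewrite subnK.
  - by rewrite addn0.
  move=> b' c' /f_supp[[-> ->]|[h1 h2] _]; first by rewrite eqxx.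
  by split; [split|]; lia.
have [led2|ltd2] := leqP d2 c.
  apply: redS (step g 0%N d2 b (c - d2)%N _ _ _ _ _) => //; first by right.
  - exact: ideal2_r.
  - by rewrite addn0.
  - by rewrite subnK.
  move=> b' c' /g_supp[[-> ->]|[h1 h2] _]; first by rewrite eqxx.
  by split; [split|]; lia.
pose i0 : 'I_N := enum_rank (Ordinal ltd, Ordinal ltd2).
exists (fun i => (i == i0)%:R) => [|i]; last first.
  by have [-> _|_] := eqVneq i i0; rewrite ?eqxx // enum_rankK; left.
rewrite (bigD1 i0) //= eqxx rmorph1 mul1r big1 => [|i /negbTE->]; last by rewrite rmorph0 mul0r.
by rewrite addr0 /m enum_rankK /= subrr; apply: ideal2_0.
Qed.

Lemma span_box (P : S) : exists (c : 'I_N -> k), I (P - \sum_i c2 (c i) * m i).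
Proof.
suff [c Ic _] : red (fun _ _ => True) P by exists c.
apply: (mon2_ind (P := red (fun _ _ => True))).
- exact: red0.
- exact: redD.
move=> a b _; rewrite /mon2 -mulrA; apply: redZ; apply: redS (red_mon a b) => //.
Qed.

Lemma f_lead : [/\ f != 0, deg2 f = d1 & lead_coef (coact2 1 1 f) = c2 (coef2 f d1 0) * x2 ^+ d1].
Proof.
apply: top_form.
- by rewrite mulf_neq0 ?x2X_neq0 // fmorph_eq0.
- by apply/deg2_leP => b c /f_supp[[-> ->]|]; lia.
apply/eqP; rewrite -subr_eq0; apply/eqP/coef2_inj => b c.
have -> : c2 (coef2 f d1 0) * x2 ^+ d1 = mon2 (coef2 f d1 0) d1 0 :> S by rewrite /mon2 mulr1.
rewrite -mulN1r -(rmorphN1 c2) coef2D coef2Z coef2_mon2 coef2_coact2 !muln1 mulN1r.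
case: eqP => [E|ne]; last by case: andP => [[/eqP h1 /eqP h2]|]; rewrite ?subrr //; case: ne; rewrite h1 h2 addn0.
have [h|/f_supp[[-> ->]|]] := eqVneq (coef2 f b c) 0; last lia.
  by case: andP => [[/eqP h1 /eqP h2]|]; rewrite ?subr0 //; rewrite -h1 -h2 h subrr.
by rewrite !eqxx subrr.
Qed.

Lemma g_lead : [/\ g != 0, deg2 g = d2 & lead_coef (coact2 1 1 g) = c2 (coef2 g 0 d2) * y2 ^+ d2].
Proof.
apply: top_form.
- by rewrite mulf_neq0 ?y2X_neq0 // fmorph_eq0.
- by apply/deg2_leP => b c /g_supp[[-> ->]|]; lia.
apply/eqP; rewrite -subr_eq0; apply/eqP/coef2_inj => b c.
have -> : c2 (coef2 g 0 d2) * y2 ^+ d2 = mon2 (coef2 g 0 d2) 0 d2 :> S by rewrite /mon2 mulr1.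
rewrite -mulN1r -(rmorphN1 c2) coef2D coef2Z coef2_mon2 coef2_coact2 !muln1 mulN1r.
case: eqP => [E|ne]; last by case: andP => [[/eqP h1 /eqP h2]|]; rewrite ?subrr //; case: ne; rewrite h1 h2.
have [h|/g_supp[[-> ->]|]] := eqVneq (coef2 g b c) 0; last lia.
  by case: andP => [[/eqP h1 /eqP h2]|]; rewrite ?subr0 //; rewrite -h1 -h2 h subrr.
by rewrite !eqxx subrr.
Qed.

Lemma NE : N = (d1 * d2)%N. Proof. by rewrite /N card_prod !card_ord. Qed.

(** A relation in which [m i0] occurs would eliminate [m i0] from the spanning set, leaving d1 d2 -
    1 elements, fewer than Bezout's inequality allows. *)
Lemma box_free (c : 'I_N -> k) : I (\sum_i c2 (c i) * m i) -> forall i, c i = 0.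
Proof.
move=> Ic i0; apply/eqP; apply: contraT => c0.
have [f0 df lf] := f_lead; have [g0 dg lg] := g_lead.
have Iunit (e : k) (u v w : S) : e != 0 -> ideal2 v w (c2 e * u) -> ideal2 v w u.
  by move=> e0 /(ideal2M (c2 e^-1)); rewrite mulrA -rmorphM mulVf // rmorph1 mul1r.
have := @bezout_tops k S f g d1 d2 N.-1 (fun i => m (lift i0 i)) f0 g0.
rewrite lf lg df dg => /(_ (Iunit _ _ _ _ f_top (ideal2_l _ _)))
  /(_ (Iunit _ _ _ _ g_top (ideal2_r _ _))) H.
suff : (d1 * d2 <= N.-1)%N by rewrite NE; case: d1 d1_gt0 d2 d2_gt0 => // ? _ [] // ? _ /=; lia.
apply: H => P; have [c' Ic'] := span_box P.
pose c'' i := c' i - c' i0 / c i0 * c i.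
have c''0 : c'' i0 = 0 by rewrite /c'' divfK // subrr.
exists (fun i => c'' (lift i0 i)).
suff [u [v E]] : I (P - \sum_i c2 (c'' (lift i0 i)) * m (lift i0 i)).
  by exists u, v; rewrite -addrA -E addrC subrK.
have -> : \sum_i c2 (c'' (lift i0 i)) * m (lift i0 i) = \sum_i c2 (c'' i) * m i.
  by rewrite [RHS](bigD1_ord i0) //= c''0 rmorph0 mul0r add0r.
have -> : \sum_i c2 (c'' i) * m i =
    \sum_i c2 (c' i) * m i - c2 (c' i0 / c i0) * \sum_i c2 (c i) * m i.
  rewrite mulr_sumr -sumrB; apply: eq_bigr => i _.
  by rewrite /c'' rmorphB rmorphM mulrBl mulrA.
by rewrite opprB addrCA addrC; apply: ideal2D => //; apply: ideal2M.
Qed.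

Lemma trace_contradiction n : I ((x2 * y2 - 1) ^+ n) -> False.
Proof.
move=> In.
have step (i : 'I_N) : exists2 c : 'I_N -> k,
    I (x2 * y2 * m i - \sum_j c2 (c j) * m j) & c i = 0.
  have [c Ic Qc] := red_mon (enum_val i).1.+1 (enum_val i).2.+1; exists c.
    by move: Ic; congr (I (_ - _)); rewrite /m !exprS; ring.
  apply/eqP; apply: contraT => /Qc; rewrite /drop /=.
  by move: (nat_of_ord _) (nat_of_ord _) => p q [[]|[]]; lia.
have step' (i : 'I_N) : exists c : 'I_N -> k,
    I (x2 * y2 * m i - \sum_j c2 (c j) * m j) /\ c i = 0.
  by have [c ? ?] := step i; exists c.
have [c hc] := fin_all_exists step'.
pose M : 'M[k]_N := \matrix_(i, j) c i j.
have trM : \tr M = 0 by rewrite /mxtrace big1 // => i _; rewrite mxE; case: (hc i).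
(* The rows of [M - 1] describe multiplication by x y - 1 on the box, so by [box_free] its
   nilpotence passes to the matrix. *)
have MX l i : I ((x2 * y2 - 1) ^+ l * m i - \sum_j c2 (((M - 1%:M) ^+ l) i j) * m j).
  elim: l i => [|l IH] i.
    rewrite expr0 mul1r (bigD1 i) //= mxE eqxx rmorph1 mul1r big1 ?addr0 ?subrr.
      exact: ideal2_0.
    by move=> j ji; rewrite mxE eq_sym (negbTE ji) rmorph0 mul0r.
  have E1 : I ((x2 * y2 - 1) * m i - \sum_j c2 ((M - 1%:M) i j) * m j).
    case: (hc i) => + _; congr I.
    have -> : \sum_j c2 ((M - 1%:M) i j) * m j = \sum_j c2 (c i j) * m j - m i.
      under eq_bigr do rewrite !mxE rmorphB mulrBl.
      rewrite sumrB; congr (_ - _); rewrite (bigD1 i) //= eqxx rmorph1 mul1r big1 ?addr0 //.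
      by move=> j ji; rewrite eq_sym (negbTE ji) rmorph0 mul0r.
    by ring.
  have -> : (x2 * y2 - 1) ^+ l.+1 * m i - \sum_j c2 (((M - 1%:M) ^+ l.+1) i j) * m j =
    (x2 * y2 - 1) ^+ l * ((x2 * y2 - 1) * m i - \sum_j c2 ((M - 1%:M) i j) * m j) +
    \sum_h c2 ((M - 1%:M) i h) * ((x2 * y2 - 1) ^+ l * m h - \sum_j c2 (((M - 1%:M) ^+ l) h j) * m j).
    have -> : \sum_h c2 ((M - 1%:M) i h) * ((x2 * y2 - 1) ^+ l * m h - \sum_j c2 (((M - 1%:M) ^+ l) h j) * m j) =
       (x2 * y2 - 1) ^+ l * \sum_j c2 ((M - 1%:M) i j) * m j - \sum_j c2 (((M - 1%:M) ^+ l.+1) i j) * m j.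
      under eq_bigr do rewrite mulrBr mulr_sumr.
      rewrite sumrB; congr (_ - _).
        by rewrite mulr_sumr; apply: eq_bigr => j _; rewrite mulrCA.
      rewrite exchange_big; apply: eq_bigr => j _ /=.
      rewrite exprS -mulmxE [in RHS]mxE rmorph_sum mulr_suml; apply: eq_bigr => h _.
      by rewrite rmorphM mulrA.
    by rewrite exprSr; ring.
  apply: ideal2D; first exact: ideal2M.
  by apply: ideal2_sum => h; apply: ideal2M.
have M0 : (M - 1%:M) ^+ n = 0.
  apply/matrixP => i j; rewrite mxE; apply: (box_free (c := fun j => ((M - 1%:M) ^+ n) i j)).
  have /(ideal2M (m i)) H := In; have := ideal2D H (ideal2M (-1) (MX n i)).
  by congr I; ring.
have := mxtrace_nilpotent M0; rewrite raddfB /= trM mxtrace1 sub0r NE => /eqP.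
rewrite oppr_eq0 => h0.
have := (pcharf0P k).1 hchar (d1 * d2)%N; rewrite h0 muln_eq0 => /esym/orP[] /eqP; lia.
Qed.
End Trace.

(** * Bihomogeneous elements and the Macaulay ideal *)

Lemma ideal2_map (A B : comNzRingType) (phi : {rmorphism A -> B}) f g h :
  ideal2 f g h -> ideal2 (phi f) (phi g) (phi h).
Proof. by case=> a [b ->]; exists (phi a), (phi b); rewrite rmorphD !rmorphM. Qed.

Lemma ideal2_sub (A : comNzRingType) (f g f' g' h : A) :
  ideal2 f' g' f -> ideal2 f' g' g -> ideal2 f g h -> ideal2 f' g' h.
Proof. by move=> If Ig [a [b ->]]; apply: ideal2D; apply: ideal2M. Qed.

Lemma coef0_divX (A : nzRingType) (P : {poly A}) : P`_0 = 0 -> exists Q, P = Q * 'X.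
Proof.
move=> P0; have /factor_theorem[Q ->] : root P 0 by rewrite /root horner_coef0 P0.
by exists Q; rewrite subr0.
Qed.

(* If f', g' is a regular pair, then T is a nonzerodivisor modulo (F, G)
   up to powers of h. *)
Lemma saturation_descend (A : idomainType) (F G : {poly A}) (h f' g' : A) N Q :
  h != 0 -> g' != 0 -> F`_0 = h * f' -> G`_0 = h * g' -> rel_prime f' g' ->
  ideal2 F G ('X^N * Q) -> ideal2 F G ((h ^+ N)%:P * Q).
Proof.
move=> h0 g0 FE GE rp; elim: N Q => [|N IH] Q; first by rewrite !expr0 polyC1.
case=> a [b E].
have E0 : a`_0 * f' = - b`_0 * g'.
  apply: (mulfI h0); apply/eqP; rewrite -subr_eq0.
  have := congr1 (fun P : {poly A} => P`_0) E; rewrite exprSr -mulrA mulrCA coefXM /=.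
  by rewrite coefD !coef0M FE GE => H0; apply/eqP; rewrite [RHS]H0; ring.
have [c aE] := rp _ _ E0.
have bE : b`_0 = - (c * f').
  apply: (mulIf g0); apply/eqP; rewrite -eqr_opp -mulNr -E0 aE; apply/eqP; ring.
(* At T = 0 the pair (a, b) is c (g', - f'). Hence h (a, b) - c (G, - F) vanishes at T = 0 and can
   be divided by T, at the price of one factor h. *)
have [a' a'E] : exists Q, h%:P * a - c%:P * G = Q * 'X.
  by apply: coef0_divX; rewrite coefB !coefCM GE aE; ring.
have [b' b'E] : exists Q, h%:P * b + c%:P * F = Q * 'X.
  by apply: coef0_divX; rewrite coefD !coefCM FE bE; ring.
rewrite exprSr polyCM -mulrA; apply: IH; exists a', b'.
have X0 : 'X != 0 :> {poly A} by rewrite polyX_eq0.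
apply: (mulIf X0).
transitivity (h%:P * ('X^(N.+1) * Q)); first by rewrite exprS; ring.
rewrite E [RHS](_ : _ = (a' * 'X) * F + (b' * 'X) * G); last by ring.
by rewrite -a'E -b'E; ring.
Qed.

Section Main.
Variables (k : closedFieldType) (R : poly4 k) (S : poly2 k).
Hypothesis hchar : [pchar k] =i pred0.

(* The parametrization, with x2, y2 in the role of s, t. *)
Definition mac : {rmorphism R -> S} :=
  ev c2 (x2 ^+ 4) (x2 ^+ 3 * y2) (x2 * y2 ^+ 3) (y2 ^+ 4).
Definition dehom : {rmorphism R -> S} := ev c2 1 x2 y2 1.
(** Restriction to w = z = 0, the line at infinity of the plane w = z; it computes the top forms of
    dehomogenizations. *)
Definition kap : {rmorphism R -> S} := ev c2 0 x2 y2 0.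
(* The grading with weight [sx * bideg1 + sy * bideg2]: (1, 0) has the minimal
   and (0, 1) the maximal components as initial forms. *)
Definition tau sx sy : {rmorphism R -> {poly R}} :=
  coact (4 * sx) (3 * sx + sy) (sx + 3 * sy) (4 * sy).
Definition tot : {rmorphism R -> {poly R}} := coact 1 1 1 1.

Definition in_mac (F : R) := mac F = 0.

Lemma tau1 sx sy F : (tau sx sy F).[1] = F. Proof. exact: coact1. Qed.
Lemma tot1 F : (tot F).[1] = F. Proof. exact: coact1. Qed.

Lemma tau_homogP sx sy n F : homog (tau sx sy) n F <->
  (forall a b c d, cf4 F a b c d != 0 ->
    (sx * bideg1 a b c d + sy * bideg2 a b c d = n)%N).
Proof.
split=> [/homog_coef h a b c d /h <-|h]; last first.
  by apply/homog_coef => a b c d /h <-; rewrite /wt /bideg1 /bideg2; nia.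
by rewrite /wt /bideg1 /bideg2; nia.
Qed.

Lemma tot_homogP n F : homog tot n F <->
  (forall a b c d, cf4 F a b c d != 0 -> (a + b + c + d = n)%N).
Proof.
split=> [/homog_coef h a b c d /h <-|h]; first by rewrite /wt !muln1.
by apply/homog_coef => a b c d /h <-; rewrite /wt !muln1.
Qed.

Lemma homog0 (A : idomainType) (t : {rmorphism A -> {poly A}}) n : homog t n 0.
Proof. by rewrite /homog rmorph0 scale0r. Qed.
Lemma homogD (A : idomainType) (t : {rmorphism A -> {poly A}}) n a b :
  homog t n a -> homog t n b -> homog t n (a + b).
Proof. by rewrite /homog rmorphD scalerDl => -> ->. Qed.
Lemma homogN (A : idomainType) (t : {rmorphism A -> {poly A}}) n a :
  homog t n a -> homog t n (- a).
Proof. by rewrite /homog rmorphN scaleNr => ->. Qed.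

Lemma homogX (A : idomainType) (t : {rmorphism A -> {poly A}}) n a m :
  homog t n a -> homog t (m * n) (a ^+ m).
Proof.
move=> h; elim: m => [|m IH]; first by rewrite /homog rmorph1 scale1r.
by rewrite exprS mulSn; apply: homogM.
Qed.

(** The parametrization is equivariant when s and t get the weights [sx] and [sy]; hence its kernel
    contains the components of its elements. *)
Lemma mac_coact sx sy F : map_poly mac (tau sx sy F) = coact2 sx sy (mac F).
Proof.
pose f : {rmorphism R -> {poly S}} := map_poly mac \o tau sx sy.
pose g : {rmorphism R -> {poly S}} := coact2 sx sy \o mac.
apply: (@ev_unique k R _ f g) => [e||||]; rewrite /f /g /= /tau /coact /mac /coact2.
- by rewrite !ev_c /= map_polyC /= ev_c ev2_c.
- rewrite !evw map_polyZ map_polyXn /= evw !rmorphXn /= ev2x.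
  by rewrite -!mul_polyC exprMn rmorphXn -exprM mulnC.
- rewrite !evx map_polyZ map_polyXn /= evx rmorphM rmorphXn /= ev2x ev2y.
  by rewrite -!mul_polyC !exprMn rmorphM rmorphXn -exprM exprD [(sx * 3)%N]mulnC; ring.
- rewrite !evy map_polyZ map_polyXn /= evy rmorphM rmorphXn /= ev2x ev2y.
  by rewrite -!mul_polyC !exprMn rmorphM rmorphXn -exprM exprD [(sy * 3)%N]mulnC; ring.
- rewrite !evz map_polyZ map_polyXn /= evz !rmorphXn /= ev2y.
  by rewrite -!mul_polyC exprMn rmorphXn -exprM mulnC.
Qed.

Lemma in_mac_comp sx sy F n : in_mac F -> in_mac (tau sx sy F)`_n.
Proof.
rewrite /in_mac -coef_map => FE.
by have := mac_coact sx sy F; rewrite FE rmorph0 => ->; rewrite coef0.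
Qed.

Lemma in_mac_prime : prime_ideal in_mac.
Proof.
rewrite /in_mac; split.
- exact: rmorph0.
- by move=> a b; rewrite rmorphD => -> ->; rewrite addr0.
- by move=> r a; rewrite rmorphM => ->; rewrite mulr0.
- by rewrite rmorph1; apply/eqP; rewrite oner_eq0.
- by move=> a b /eqP; rewrite rmorphM mulf_eq0 => /orP[] /eqP; [left|right].
Qed.

(** Bihomogeneous elements of p, chosen for their restrictions. Under [dehom], [qa], [qb], [qc] and
    [qe] become x^4 - 1, y^4 - 1, y - x^3 and x y - 1; under [kap], [qc] and [qd] become - x^3 and
    y^3. *)
Definition qa : R := x4 ^+ 4 - w4 ^+ 3 * z4.
Definition qb : R := y4 ^+ 4 - w4 * z4 ^+ 3.
Definition qc : R := w4 ^+ 2 * y4 - x4 ^+ 3.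
Definition qd : R := y4 ^+ 3 - x4 * z4 ^+ 2.
Definition qe : R := x4 * y4 - w4 * z4.

Definition tau_hom_mac q := in_mac q /\ forall sx sy, exists n, homog (tau sx sy) n q.

Lemma q_hom (b c : R) m n a1 a2 a3 a4 b1 b2 b3 b4 :
  b = w4 ^+ a1 * x4 ^+ a2 * y4 ^+ a3 * z4 ^+ a4 ->
  c = w4 ^+ b1 * x4 ^+ b2 * y4 ^+ b3 * z4 ^+ b4 ->
  bideg1 a1 a2 a3 a4 = m -> bideg1 b1 b2 b3 b4 = m ->
  bideg2 a1 a2 a3 a4 = n -> bideg2 b1 b2 b3 b4 = n ->
  tau_hom_mac (b - c).
Proof.
move=> -> -> h1 h2 h3 h4; split.
  have mE e1 e2 e3 e4 : mac (w4 ^+ e1 * x4 ^+ e2 * y4 ^+ e3 * z4 ^+ e4) =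
     x2 ^+ bideg1 e1 e2 e3 e4 * y2 ^+ bideg2 e1 e2 e3 e4.
    rewrite /mac !rmorphM !rmorphXn evw evx evy evz /bideg1 /bideg2 !exprMn !exprD.
    by ring.
  by rewrite /in_mac rmorphB /= !mE h1 h2 h3 h4 subrr.
move=> sx sy; exists (sx * m + sy * n)%N.
have mH e1 e2 e3 e4 : homog (tau sx sy) (sx * bideg1 e1 e2 e3 e4 + sy * bideg2 e1 e2 e3 e4)
    (w4 ^+ e1 * x4 ^+ e2 * y4 ^+ e3 * z4 ^+ e4).
  apply/tau_homogP => a b' c' d.
  have -> : w4 ^+ e1 * x4 ^+ e2 * y4 ^+ e3 * z4 ^+ e4 = mon 1 e1 e2 e3 e4 :> R.
    by rewrite /mon rmorph1 mul1r.
  by rewrite coef_mon; case: ifP => [/and4P[/eqP-> /eqP-> /eqP-> /eqP->]|]; rewrite ?eqxx.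
apply: homogD; last apply: homogN.
  by rewrite -h1 -h3; apply: mH.
by rewrite -h2 -h4; apply: mH.
Qed.

Lemma qa_hom : tau_hom_mac qa.
Proof. by apply: (q_hom (a1 := 0) (a2 := 4) (a3 := 0) (a4 := 0) (b1 := 3) (b2 := 0) (b3 := 0) (b4 := 1)); rewrite ?expr0 ?expr1 ?mulr1 ?mul1r. Qed.
Lemma qb_hom : tau_hom_mac qb.
Proof. by apply: (q_hom (a1 := 0) (a2 := 0) (a3 := 4) (a4 := 0) (b1 := 1) (b2 := 0) (b3 := 0) (b4 := 3)); rewrite ?expr0 ?expr1 ?mulr1 ?mul1r. Qed.
Lemma qc_hom : tau_hom_mac qc.
Proof. by apply: (q_hom (a1 := 2) (a2 := 0) (a3 := 1) (a4 := 0) (b1 := 0) (b2 := 3) (b3 := 0) (b4 := 0)); rewrite ?expr0 ?expr1 ?mulr1 ?mul1r. Qed.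
Lemma qd_hom : tau_hom_mac qd.
Proof. by apply: (q_hom (a1 := 0) (a2 := 0) (a3 := 3) (a4 := 0) (b1 := 0) (b2 := 1) (b3 := 0) (b4 := 2)); rewrite ?expr0 ?expr1 ?mulr1 ?mul1r. Qed.
Lemma qe_hom : tau_hom_mac qe.
Proof. by apply: (q_hom (a1 := 0) (a2 := 1) (a3 := 1) (a4 := 0) (b1 := 1) (b2 := 0) (b3 := 0) (b4 := 1)); rewrite ?expr0 ?expr1 ?mulr1 ?mul1r. Qed.

Lemma dehom_supp F b c : coef2 (dehom F) b c != 0 -> exists a d, cf4 F a b c d != 0.
Proof.
move=> ne; apply: NNPP => h; case/eqP: ne.
apply: (mon_ind (P := fun F => coef2 (dehom F) b c = 0)).
- by rewrite rmorph0 coef2_0.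
- by move=> G H hG hH; rewrite rmorphD coef2D hG hH addr0.
move=> a b' c' d cn; rewrite /dehom ev_mon !expr1n !mulr1 -/(mon2 _ _ _) coef2_mon2.
by case: ifP => // /andP[/eqP hb /eqP hc]; case: h; exists a, d; rewrite hb hc.
Qed.

Definition bihom i j F := homog (tau 1 0) i F /\ homog (tau 0 1) j F.

Lemma bihomP i j F : bihom i j F <->
  (forall a b c d, cf4 F a b c d != 0 -> bideg1 a b c d = i /\ bideg2 a b c d = j).
Proof.
split=> [[/tau_homogP h1 /tau_homogP h2] a b c d cn|h].
  by have := h1 _ _ _ _ cn; have := h2 _ _ _ _ cn; rewrite mul1n !mul0n mul1n addn0 add0n.
by split; apply/tau_homogP => a b c d /h[h1 h2]; rewrite h1 h2 mul1n mul0n ?addn0 ?add0n.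
Qed.

(** For a fixed bidegree the exponents b and c determine a and d, so no two monomials merge when w =
    z = 1. *)
Lemma dehom_coef i j F a b c d : bihom i j F -> bideg1 a b c d = i -> bideg2 a b c d = j ->
  coef2 (dehom F) b c = cf4 F a b c d.
Proof.
move=> /bihomP hF h1 h2.
apply: (mon_ind (P := fun F => coef2 (dehom F) b c = cf4 F a b c d)).
- by rewrite rmorph0 coef2_0 cf4_0.
- by move=> G H hG hH; rewrite rmorphD coef2D cf4D hG hH.
move=> a' b' c' d' /hF[h1' h2'].
rewrite /dehom ev_mon !expr1n !mulr1 -/(mon2 _ _ _) coef2_mon2 coef_mon.
move: h1 h2; rewrite -h1' -h2' /bideg1 /bideg2.
case: (b =P b') => [->|]; rewrite ?andbF //; case: (c =P c') => [->|]; rewrite ?andbF //= => e1 e2.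
have -> : a = a' by lia.
have -> : d = d' by lia.
by rewrite !eqxx.
Qed.

Lemma dehom_neq0 i j F : bihom i j F -> F != 0 -> dehom F != 0.
Proof.
move=> hF F0; have [a [b [c [d cn]]]] := cf4_neq0 F0.
have [h1 h2] := (bihomP i j F).1 hF _ _ _ _ cn.
by apply: contraNneq cn => h; rewrite -(dehom_coef hF h1 h2) h coef2_0.
Qed.

(** A monomial containing w or z loses degree when these become 1; the part of full degree is what
    [kap] keeps. *)
Lemma dehom_top n F : homog tot n F ->
  (deg2 (dehom F) <= n)%N /\ (coact2 1 1 (dehom F))`_n = kap F.
Proof.
move=> /tot_homogP hF; split.
  apply/deg2_leP => b c /dehom_supp[a [d /hF <-]]; lia.
apply: (mon_ind (P := fun F => (coact2 1 1 (dehom F))`_n = kap F)).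
- by rewrite !rmorph0 coef0.
- by move=> G H hG hH; rewrite !rmorphD coefD hG hH.
move=> a b c d /hF; rewrite /dehom /kap !ev_mon !expr1n !mulr1 -/(mon2 _ _ _) coact2_mon coefZ coefXn !muln1 => <-.
case: eqP => [h|ne].
  have -> : a = 0%N by lia.
  have -> : d = 0%N by lia.
  by rewrite !expr0 !mulr1.
rewrite mulr0; case: a ne => [|a] ne; last by rewrite exprS mul0r mulr0 !mul0r.
by case: d ne => [|d] ne; [case: ne; lia|rewrite [0 ^+ d.+1]exprS mul0r mulr0].
Qed.

Lemma tot_gdeg F a b c d : cf4 F a b c d != 0 -> (a + b + c + d <= gdeg tot F)%N.
Proof.
apply: contraNT; rewrite -ltnNge => lt.
have := cf4_coact 1 1 1 1 (a + b + c + d) F a b c d; rewrite /wt !muln1 eqxx => <-.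
rewrite nth_default ?cf4_0 //; move: lt; rewrite /gdeg; by case: (size _).
Qed.

Lemma deg2_dehom F : (deg2 (dehom F) <= gdeg tot F)%N.
Proof. by apply/deg2_leP => b c /dehom_supp[a [d /tot_gdeg]]; lia. Qed.

Lemma gdeg0_const F : gdeg tot F = 0%N -> exists e, F = c4 e.
Proof.
move=> h; apply: (mon_ind (P := fun F => exists e, F = c4 e)).
- by exists 0; rewrite rmorph0.
- by move=> G H [e ->] [e' ->]; exists (e + e'); rewrite rmorphD.
move=> a b c d /tot_gdeg; rewrite h leqn0 !addn_eq0 => /andP[/andP[/andP[/eqP-> /eqP->] /eqP->] /eqP->].
by exists (cf4 F 0 0 0 0); rewrite /mon !mulr1.
Qed.
End Main.

(** * Degeneration to the initial forms *)

Lemma ideal2C (A : comNzRingType) (f g a : A) : ideal2 f g a -> ideal2 g f a.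
Proof. by case=> u [v ->]; exists v, u; rewrite addrC. Qed.

Lemma ideal2_unit (A : comUnitRingType) (f g u a : A) : u \is a GRing.unit ->
  ideal2 f g (u * a) -> ideal2 f g a.
Proof. by move=> uU /(ideal2M u^-1); rewrite mulKr. Qed.

Section BihomogeneousCase.
Variables (k : closedFieldType) (R : poly4 k) (S : poly2 k).
Hypothesis hchar : [pchar k] =i pred0.
Local Notation dehom := (@dehom k R S).
Local Notation kap := (@kap k R S).

(** Setting y = 0 as well leaves only the pure powers of x; without any, a power of x would lie in
    the zero ideal. *)
Lemma pure_term_x (f g : R) d1 d2 :
  homog (@tot k R) d1 f -> homog (@tot k R) d2 g ->
  (exists N, ideal2 (kap f) (kap g) (x2 ^+ N)) ->
  cf4 f 0 d1 0 0 != 0 \/ cf4 g 0 d2 0 0 != 0.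
Proof.
move=> /tot_homogP hf /tot_homogP hg [N Ix].
pose phi : {rmorphism S -> S} := ev2 c2 x2 0.
have kE (F : R) d : (forall a b c d0, cf4 F a b c d0 != 0 -> (a + b + c + d0 = d)%N) ->
    cf4 F 0 d 0 0 = 0 -> phi (kap F) = 0.
  move=> hF F0; apply: (mon_ind (P := fun F => phi (kap F) = 0)).
  - by rewrite !rmorph0.
  - by move=> G H hG hH; rewrite !rmorphD /= hG hH addr0.
  move=> a b c e cn; have := hF _ _ _ _ cn; move: cn.
  rewrite /kap ev_mon !rmorphM !rmorphXn /phi /= !rmorph0 ev2_c ev2x ev2y.
  case: a => [|a]; last by rewrite [0 ^+ a.+1]exprS mul0r mulr0 !mul0r.
  case: c => [|c]; last by rewrite [0 ^+ c.+1]exprS mul0r mulr0 !mul0r.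
  case: e => [|e]; last by rewrite [0 ^+ e.+1]exprS mul0r mulr0.
  by rewrite !addn0 add0n => + bE; rewrite bE F0 eqxx.
have [f0|] := eqVneq (cf4 f 0 d1 0 0) 0; last by left.
have [g0|] := eqVneq (cf4 g 0 d2 0 0) 0; last by right.
exfalso; have := ideal2_map phi Ix.
rewrite (kE _ _ hf f0) (kE _ _ hg g0) rmorphXn /phi /= ev2x => -[u [v /eqP]].
by rewrite !mulr0 addr0 (negbTE (x2X_neq0 S N)).
Qed.

Lemma pure_term_y (f g : R) d1 d2 :
  homog (@tot k R) d1 f -> homog (@tot k R) d2 g ->
  (exists N, ideal2 (kap f) (kap g) (y2 ^+ N)) ->
  cf4 f 0 0 d1 0 != 0 \/ cf4 g 0 0 d2 0 != 0.
Proof.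
move=> /tot_homogP hf /tot_homogP hg [N Ix].
pose phi : {rmorphism S -> S} := ev2 c2 0 y2.
have kE (F : R) d : (forall a b c d0, cf4 F a b c d0 != 0 -> (a + b + c + d0 = d)%N) ->
    cf4 F 0 0 d 0 = 0 -> phi (kap F) = 0.
  move=> hF F0; apply: (mon_ind (P := fun F => phi (kap F) = 0)).
  - by rewrite !rmorph0.
  - by move=> G H hG hH; rewrite !rmorphD /= hG hH addr0.
  move=> a b c e cn; have := hF _ _ _ _ cn; move: cn.
  rewrite /kap ev_mon !rmorphM !rmorphXn /phi /= !rmorph0 ev2_c ev2x ev2y.
  case: a => [|a]; last by rewrite [0 ^+ a.+1]exprS mul0r mulr0 !mul0r.
  case: b => [|b]; last by rewrite [0 ^+ b.+1]exprS mul0r mulr0 !mul0r.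
  case: e => [|e]; last by rewrite [0 ^+ e.+1]exprS mul0r mulr0.
  by rewrite !addn0 !add0n => + bE; rewrite bE F0 eqxx.
have [f0|] := eqVneq (cf4 f 0 0 d1 0) 0; last by left.
have [g0|] := eqVneq (cf4 g 0 0 d2 0) 0; last by right.
exfalso; have := ideal2_map phi Ix.
rewrite (kE _ _ hf f0) (kE _ _ hg g0) rmorphXn /phi /= ev2y => -[u [v /eqP]].
by rewrite !mulr0 addr0 (negbTE (y2X_neq0 S N)).
Qed.

Lemma bihom_case (f g : R) d1 d2 i1 j1 i2 j2 n :
  (0 < d1)%N -> (0 < d2)%N ->
  homog (@tot k R) d1 f -> homog (@tot k R) d2 g -> bihom i1 j1 f -> bihom i2 j2 g ->
  cf4 f 0 d1 0 0 != 0 -> cf4 g 0 0 d2 0 != 0 ->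
  ideal2 f g (@qe k R ^+ n) -> False.
Proof.
move=> d10 d20 tf tg bf bg fx gy In.
have [i1E j1E] := (bihomP _ _ _).1 bf _ _ _ _ fx.
have [i2E j2E] := (bihomP _ _ _).1 bg _ _ _ _ gy.
apply: (@trace_contradiction k S (dehom f) (dehom g) d1 d2 hchar d10 d20 _ _ _ _ n).
- by rewrite (dehom_coef S bf i1E j1E).
- move=> b c /dehom_supp[a [d cn]].
  have [] := (bihomP _ _ _).1 bf _ _ _ _ cn; have := (tot_homogP _ _).1 tf _ _ _ _ cn.
  (* The total degree and the second degree both equal d1, so a = 2 c + 3 d. Unless c = d = 0 this
     forces a >= 2, and 3 b + c = 3 d1 - 4 a. *)
  rewrite -i1E -j1E /bideg1 /bideg2; case: c {cn} => [|c]; first case: d => [|d]; lia.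
- by rewrite (dehom_coef S bg i2E j2E).
- move=> b c /dehom_supp[a [d cn]].
  have [] := (bihomP _ _ _).1 bg _ _ _ _ cn; have := (tot_homogP _ _).1 tg _ _ _ _ cn.
  (* Symmetrically, d = 3 a + 2 b. *)
  rewrite -i2E -j2E /bideg1 /bideg2; case: b {cn} => [|b]; first case: a => [|a]; lia.
have := ideal2_map dehom In; congr ideal2.
by rewrite rmorphXn /qe rmorphB !rmorphM /= /dehom evw evx evy evz mulr1.
Qed.
End BihomogeneousCase.

(** * The family over k[T] and its limit *)

Section Degeneration.
Variables (k : closedFieldType) (R : poly4 k) (S : poly2 k).
Hypothesis hchar : [pchar k] =i pred0.
Local Notation dehom := (@dehom k R S).
Local Notation kap := (@kap k R S).
Local Notation tot := (@tot k R).
Local Notation in_mac := (@in_mac k R S).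

Variables (f g : R) (sx sy i0 j0 : nat) (F G : {poly R}) (h f' g' : R).
Local Notation tau := (@tau k R sx sy).
Hypothesis hrad : forall q, in_mac q -> exists n, ideal2 f g (q ^+ n).
Hypothesis tf : tau f = 'X^i0 * F.
Hypothesis tg : tau g = 'X^j0 * G.
Hypothesis f0E : F`_0 = h * f'.
Hypothesis g0E : G`_0 = h * g'.
Hypothesis f0_neq0 : h * f' != 0.
Hypothesis g0_neq0 : h * g' != 0.
Hypothesis rp : rel_prime f' g'.

Let h0 : h != 0. Proof. by apply: contraNneq f0_neq0 => ->; rewrite mul0r. Qed.
Let f'0 : f' != 0. Proof. by apply: contraNneq f0_neq0 => ->; rewrite mulr0. Qed.
Let g'0 : g' != 0. Proof. by apply: contraNneq g0_neq0 => ->; rewrite mulr0. Qed.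

(** Applying [tau] to a relation q^n = u f + v g multiplies the left side by T^(n e). *)
Lemma rees_pow q e : in_mac q -> homog tau e q ->
  exists N n, ideal2 F G ('X^N * (q ^+ n)%:P).
Proof.
move=> /hrad[n [u [v E]]] hq; exists (n * e)%N, n.
exists (tau u * 'X^i0), (tau v * 'X^j0).
have := congr1 tau E; rewrite (homogX n hq) rmorphD !rmorphM tf tg.
by rewrite -mul_polyC mulrC => ->; ring.
Qed.

(** [saturation_descend] trades the power of T for a power of [h]; then T can be set to 0. *)
Lemma limit_pow q e : in_mac q -> homog tau e q ->
  exists N n, ideal2 f' g' (h ^+ N * q ^+ n).
Proof.
move=> mq hq; have [N [n I]] := rees_pow mq hq; exists N, n.
have [a [b E]] := saturation_descend h0 g'0 f0E g0E rp I.
exists (a`_0 * h), (b`_0 * h).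
have := congr1 (fun P : {poly R} => P`_0) E.
by rewrite -polyCM coefC /= coefD !coef0M f0E g0E !mulrA.
Qed.

(** The components of [q] again lie in p, and [limit_pow] applies to each of them. *)
Lemma prime_over_limit (P : R -> Prop) : prime_ideal P -> P f' -> P g' -> ~ P h ->
  forall q, in_mac q -> P q.
Proof.
move=> [P0 PD PM P1 PP] Pf Pg nPh q mq.
have PX a n : P (a ^+ n) -> P a.
  by elim: n => [|n IH]; rewrite ?expr0 // exprS => /PP[].
rewrite (sum_homog (@tau1 k R sx sy) q); elim/big_ind: _ => // i _.
have [N [n [a [b E]]]] := limit_pow (in_mac_comp sx sy i mq) (coactK _ _ _ _ q i).
have : P (h ^+ N * (tau q)`_i ^+ n) by rewrite E; apply: PD; apply: PM.
by case/PP => /PX.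
Qed.

(** [u] is invertible modulo (a, b), and a power of each of [a] and [b] sends [s] into [J]; so [u]
    can be cancelled. Double induction on the two exponents. *)
Lemma unit_mod_nilpotent (J : S -> Prop) (u v A a B b s : S) m n :
  (forall x y, J x -> J y -> J (x + y)) -> (forall x y, J y -> J (x * y)) ->
  1 = u * v + A * a + B * b ->
  J (a ^+ m * s) -> J (b ^+ n * s) -> J (u * s) -> J s.
Proof.
move=> JD JM E; elim: m n s => [|m IHm] n s; first by rewrite expr0 mul1r.
elim: n s => [|n IHn] s; first by rewrite expr0 mul1r.
move=> Ja Jb Ju.
have Jas : J (a * s).
  apply: (IHm n.+1); first by rewrite mulrA -exprSr.
    by rewrite mulrCA; apply: JM.
  by rewrite mulrCA; apply: JM.
have Jbs : J (b * s).
  apply: IHn; first by rewrite mulrCA; apply: JM.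
    by rewrite mulrA -exprSr.
  by rewrite mulrCA; apply: JM.
have -> : s = v * (u * s) + A * (a * s) + B * (b * s) by rewrite -[LHS]mul1r E; ring.
by apply: (JD _ _ (JD _ _ _ _)); apply: JM.
Qed.

Lemma curve_neq0 : y2 - x2 ^+ 3 != 0 :> S.
Proof.
apply/eqP => /(congr1 (fun s => coef2 s 0 1)).
have -> : y2 - x2 ^+ 3 = mon2 1 0 1 + mon2 (-1) 3 0 :> S.
  by rewrite /mon2 !expr0 !mulr1 rmorph1 mul1r rmorphN1 expr1 mulN1r.
by rewrite coef2D !coef2_mon2 coef2_0 /= addr0 => /eqP; rewrite oner_eq0.
Qed.

(** The substitution y = x^3 kills only multiples of y - x^3, and it does not kill x^4 - 1. *)
Lemma rel_prime_curve n m :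
  rel_prime ((x2 ^+ 4 - 1) ^+ n : S) ((y2 - x2 ^+ 3) ^+ m).
Proof.
pose phi : {rmorphism S -> S} := ev2 c2 x2 (x2 ^+ 3).
have px : phi x2 = x2 by rewrite /phi ev2x.
have py : phi y2 = x2 ^+ 3 by rewrite /phi ev2y.
have diff s : divides (y2 - x2 ^+ 3) (s - phi s).
  apply: (mon2_ind (P := fun s => divides (y2 - x2 ^+ 3) (s - phi s))).
  - by exists 0; rewrite rmorph0 subrr mul0r.
  - by move=> s' t ds dt; rewrite rmorphD opprD addrACA; apply: dividesD.
  move=> a b _; rewrite {2}/mon2 !rmorphM !rmorphXn px py /phi ev2_c /mon2 -mulrBr.
  by apply: divides_mull; rewrite subrXX; apply: divides_mulr; exists 1; rewrite mul1r.
have x41 : x2 ^+ 4 - 1 != 0 :> S.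
  apply/eqP => /(congr1 (fun s => coef2 s 4 0)).
  have -> : x2 ^+ 4 - 1 = mon2 1 4 0 + mon2 (-1) 0 0 :> S.
    by rewrite /mon2 !expr0 !mulr1 rmorph1 mul1r rmorphN1.
  by rewrite coef2D !coef2_mon2 coef2_0 /= addr0 => /eqP; rewrite oner_eq0.
have yx3 := curve_neq0.
elim: m => [|m IH] a b E; first by exists a; rewrite expr0 mulr1.
have pa : phi a = 0.
  have e1 : phi ((x2 ^+ 4 - 1) ^+ n) = (x2 ^+ 4 - 1) ^+ n.
    by rewrite rmorphXn rmorphB rmorph1 rmorphXn px.
  have e2 : phi ((y2 - x2 ^+ 3) ^+ m.+1) = 0.
    by rewrite rmorphXn rmorphB rmorphXn px py subrr expr0n.
  have := congr1 phi E; rewrite !rmorphM e1 e2 mulr0 => /eqP.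
  by rewrite mulf_eq0 expf_eq0 (negbTE x41) andbF orbF => /eqP.
have [a1 aE] := diff a; rewrite pa subr0 in aE.
have [|c cE] := IH a1 b.
  by apply: (mulIf yx3); rewrite -[RHS]mulrA -exprSr -E aE; ring.
by exists c; rewrite aE cE [_ ^+ m.+1]exprSr mulrA.
Qed.

(** The points of the curve in the plane have parameters s = 1 and t = x with x^4 = 1. There c s^i
    t^j becomes c x^j, with the same constant c. *)
Lemma homog_dehom_curve i j (H : R) : bihom i j H -> exists c : k,
  @mac k R S H = c2 c * x2 ^+ i * y2 ^+ j /\
  ideal2 (x2 ^+ 4 - 1) (y2 - x2 ^+ 3) (dehom H - c2 c * x2 ^+ j).
Proof.
move=> /bihomP hH.
set I := ideal2 _ _.
have powI (x y : S) n : I (x - y) -> I (x ^+ n - y ^+ n).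
  by move=> Ixy; rewrite subrXX mulrC; apply: ideal2M.
apply: (mon_ind (P := fun H => exists c : k,
  @mac k R S H = c2 c * x2 ^+ i * y2 ^+ j /\ I (dehom H - c2 c * x2 ^+ j))).
- by exists 0; rewrite !rmorph0 !mul0r subrr; split=> //; apply: ideal2_0.
- move=> A B [c [cE cI]] [c' [cE' cI']]; exists (c + c'); split.
    by rewrite !rmorphD cE cE' /=; ring.
  have -> : dehom (A + B) - c2 (c + c') * x2 ^+ j =
     (dehom A - c2 c * x2 ^+ j) + (dehom B - c2 c' * x2 ^+ j) by rewrite !rmorphD; ring.
  exact: ideal2D.
move=> a b c d /hH[<- <-]; set e := cf4 _ _ _ _ _; exists e; split.
  rewrite /mac ev_mon /bideg1 /bideg2 !exprMn !exprD; ring.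
rewrite /dehom ev_mon !expr1n !mulr1 -mulrA -mulrBr; apply: ideal2M.
have -> : x2 ^+ b * y2 ^+ c - x2 ^+ bideg2 a b c d =
   x2 ^+ b * (y2 ^+ c - (x2 ^+ 3) ^+ c) - x2 ^+ (b + 3 * c) * ((x2 ^+ 4) ^+ d - 1 ^+ d) :> S.
  by rewrite /bideg2 expr1n -!exprM [x2 ^+ (b + _ + _)]exprD [x2 ^+ (b + _)]exprD; ring.
apply: ideal2D; first by apply: ideal2M; apply: powI; apply: ideal2_r.
by rewrite -[X in ideal2 _ _ X]mulN1r; do 2 apply: ideal2M; apply: powI; apply: ideal2_l.
Qed.

Variables (d1 d2 i1 j1 i2 j2 : nat).
Hypothesis mf : in_mac f.
Hypothesis mg : in_mac g.
Hypothesis Fhom : forall n, homog tot d1 F`_n.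
Hypothesis Ghom : forall n, homog tot d2 G`_n.
Hypothesis f0_bihom : bihom i1 j1 (h * f').
Hypothesis g0_bihom : bihom i2 j2 (h * g').
Hypothesis h_notin : ~ in_mac h.

Local Notation F1 := (map_poly dehom F).
Local Notation G1 := (map_poly dehom G).
Local Notation J := (initI F1 G1).

Lemma homog_const_notin (H : R) : H != 0 -> homog tot 0 H -> ~ in_mac H.
Proof.
move=> H0 hH mH; have [e HE] := gdeg0_const (homog_gdeg H0 hH).
case/eqP: H0; move: mH; rewrite HE /in_mac /mac ev_c => /eqP.
by rewrite fmorph_eq0 => /eqP->; rewrite rmorph0.
Qed.

Let d1_gt0 : (0 < d1)%N.
Proof.
rewrite lt0n; apply/eqP => E; have := Fhom 0; rewrite f0E E => /(homog_const_notin f0_neq0); apply.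
have := in_mac_comp sx sy i0 mf.
by rewrite tf coefXnM ltnn subnn f0E.
Qed.

Let d2_gt0 : (0 < d2)%N.
Proof.
rewrite lt0n; apply/eqP => E; have := Ghom 0; rewrite g0E E => /(homog_const_notin g0_neq0); apply.
have := in_mac_comp sx sy j0 mg.
by rewrite tg coefXnM ltnn subnn g0E.
Qed.

Lemma bihom_factor i j (u v : R) : u * v != 0 -> bihom i j (u * v) -> exists i' j', bihom i' j' u.
Proof.
move=> uv0 [b1 b2].
have [i' h1] := homog_factor (@tau1 k R 1 0) uv0 b1.
have [j' h2] := homog_factor (@tau1 k R 0 1) uv0 b2.
by exists i', j'.
Qed.

Lemma satI_q q : tau_hom_mac S q -> exists n, satI F1 G1 ((dehom q ^+ n)%:P).
Proof.
case=> mq /(_ sx sy)[e hq]; have [N [n I]] := rees_pow mq hq; exists n, N.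
have := ideal2_map (map_poly dehom) I; congr ideal2.
by rewrite rmorphM /= map_polyXn map_polyC /= rmorphXn.
Qed.

Lemma initI_q q : tau_hom_mac S q -> exists n, J (dehom q ^+ n).
Proof. by move=> /satI_q[n sn]; exists n; exists ((dehom q ^+ n)%:P) => //; rewrite coefC. Qed.

Let dehom_qa : dehom (@qa k R) = x2 ^+ 4 - 1.
Proof. by rewrite /qa rmorphB rmorphXn rmorphM rmorphXn /= /dehom evw evx evz expr1n mulr1. Qed.
Let dehom_qb : dehom (@qb k R) = y2 ^+ 4 - 1.
Proof. by rewrite /qb rmorphB rmorphXn rmorphM rmorphXn /= /dehom evw evy evz expr1n mulr1. Qed.
Let dehom_qc : dehom (@qc k R) = y2 - x2 ^+ 3.
Proof. by rewrite /qc rmorphB rmorphM !rmorphXn /= /dehom evw evx evy expr1n mul1r. Qed.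

(** As [h] is not in p, its restriction to the four points is c x^j with c nonzero. This is a unit
    because x^4 = 1 there, and powers of x^4 - 1 and y - x^3 lie in the limit ideal. *)
Lemma initI_cancel_h s : J (dehom h * s) -> J s.
Proof.
have [i [j hh]] := bihom_factor f0_neq0 f0_bihom.
have [c [hE [A [B E]]]] := homog_dehom_curve hh.
have c0 : c != 0 by apply: contra_not_neq h_notin => c0; rewrite /in_mac hE c0 rmorph0 !mul0r.
have [n1] := initI_q (qa_hom R S); have [n2] := initI_q (qc_hom R S).
rewrite dehom_qa dehom_qc => J2 J1 Js.
have [A' [B' E']] : ideal2 (x2 ^+ 4 - 1) (y2 - x2 ^+ 3) ((x2 ^+ 4) ^+ j - 1 ^+ j : S).
  by rewrite subrXX mulrC; apply: ideal2M; apply: ideal2_l.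
(* The inverse of c x^j modulo x^4 - 1. *)
pose v : S := c2 c^-1 * x2 ^+ (3 * j).
have cc : c2 c^-1 * c2 c = 1 :> S by rewrite -rmorphM mulVf // rmorph1.
have xj : x2 ^+ (3 * j) * x2 ^+ j = (x2 ^+ 4) ^+ j :> S by rewrite -exprD -exprM; congr (_ ^+ _); lia.
have hE' : dehom h = A * (x2 ^+ 4 - 1) + B * (y2 - x2 ^+ 3) + c2 c * x2 ^+ j by rewrite -E subrK.
apply: (@unit_mod_nilpotent J (dehom h) v (- (A' + A * v)) (x2 ^+ 4 - 1)
          (- (B' + B * v)) (y2 - x2 ^+ 3) s n1 n2) => //.
- exact: initID.
- exact: initIM.
- rewrite hE'.
  rewrite [LHS](_ : _ = (c2 c^-1 * c2 c) * (x2 ^+ (3 * j) * x2 ^+ j) -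
    (A' * (x2 ^+ 4 - 1) + B' * (y2 - x2 ^+ 3))).
    by rewrite /v; ring.
  by rewrite -E' cc xj expr1n; ring.
- by rewrite mulrC; apply: initIM.
- by rewrite mulrC; apply: initIM.
Qed.

Lemma initI_f' : J (dehom f') /\ J (dehom g').
Proof.
have sF : satI F1 G1 F1 by exists 0%N; rewrite mul1r; apply: ideal2_l.
have sG : satI F1 G1 G1 by exists 0%N; rewrite mul1r; apply: ideal2_r.
split; apply: initI_cancel_h; rewrite -rmorphM.
  by exists F1 => //; rewrite coef_map f0E.
by exists G1 => //; rewrite coef_map g0E.
Qed.

Let bihom_f' : exists i j, bihom i j f'.
Proof.
have := f0_bihom; have := f0_neq0; rewrite mulrC => n0 b0.
exact: bihom_factor n0 b0.
Qed.
Let bihom_g' : exists i j, bihom i j g'.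
Proof.
have := g0_bihom; have := g0_neq0; rewrite mulrC => n0 b0.
exact: bihom_factor n0 b0.
Qed.

(** By [limit_pow] a common factor [u] of the restrictions divides h^N (x^4 - 1)^n1 and h^N (y -
    x^3)^n2. The last factors are coprime, so [u] divides h^N and can be cancelled in the limit
    ideal. *)
Lemma coprime_in_J : exists f2 g2 : S,
  [/\ f2 != 0, g2 != 0, rel_prime f2 g2, J f2 & J g2] /\
  (deg2 f2 <= deg2 (dehom f'))%N /\ (deg2 g2 <= deg2 (dehom g'))%N.
Proof.
have [i [j bf]] := bihom_f'; have [i' [j' bg]] := bihom_g'.
have f1 := dehom_neq0 S bf f'0; have g1 := dehom_neq0 S bg g'0.
have [u [f2 [g2 [fE gE rp2]]]] := rel_prime_gcd (@ufd2 k S) f1 g1.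
have u0 : u != 0 by apply: contraNneq f1 => e; rewrite fE e mul0r.
have f20 : f2 != 0 by apply: contraNneq f1 => e; rewrite fE e mulr0.
have g20 : g2 != 0 by apply: contraNneq g1 => e; rewrite gE e mulr0.
have uI q : tau_hom_mac S q -> exists N n, divides u (dehom h ^+ N * dehom q ^+ n).
  case=> mq /(_ sx sy)[e hq]; have [N [n I]] := limit_pow mq hq; exists N, n.
  have [a [b]] := ideal2_map dehom I; rewrite rmorphM !rmorphXn => ->.
  by exists (a * f2 + b * g2); rewrite fE gE; ring.
have [N1 [n1]] := uI _ (qa_hom R S); have [N2 [n2]] := uI _ (qc_hom R S).
rewrite dehom_qa dehom_qc => u2 u1; pose N := (N1 + N2)%N.
have [A EA] : divides u (dehom h ^+ N * (x2 ^+ 4 - 1) ^+ n1).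
  by rewrite /N exprD mulrAC; apply: divides_mulr.
have [B EB] : divides u (dehom h ^+ N * (y2 - x2 ^+ 3) ^+ n2).
  by rewrite /N exprD -mulrA; apply: divides_mull.
have q20 : (y2 - x2 ^+ 3) ^+ n2 != 0 :> S by rewrite expf_neq0 // curve_neq0.
have [|C BE] := @rel_prime_curve n1 n2 B A.
  by apply: (mulfI u0); rewrite mulrA [u * B]mulrC -EB mulrA [u * A]mulrC -EA mulrAC.
have hE : dehom h ^+ N = C * u by apply: (mulIf q20); rewrite EB BE mulrAC.
have cancelX l s : J (dehom h ^+ l * s) -> J s.
  elim: l s => [|l IH] s; first by rewrite expr0 mul1r.
  by rewrite exprSr -mulrA => /IH/initI_cancel_h.
have [Jf Jg] := initI_f'.
exists f2, g2; split; last first.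
  by rewrite fE gE !deg2M // !leq_addl.
split=> //; apply: (cancelX N); rewrite hE -mulrA; apply: initIM.
  by rewrite -fE.
by rewrite -gE.
Qed.

Lemma Fl_homog (H : {poly R}) n (l : k) :
  (forall m, homog tot n H`_m) -> homog tot n H.[c4 l].
Proof.
move=> hH; rewrite horner_coef; elim/big_ind: _.
- exact: homog0.
- exact: homogD.
move=> i _; rewrite -[n]addn0; apply: homogM => //.
have c0 : homog tot 0 (c4 l : R).
  by rewrite /homog /tot /coact ev_c /= expr0 alg_polyC.
by have := homogX i c0; rewrite muln0.
Qed.

Lemma horner_map_dehom (H : {poly R}) (l : k) : (map_poly dehom H).[c2 l] = dehom H.[c4 l].
Proof. by rewrite -horner_map /= /dehom ev_c. Qed.

(** At T = l the power of T is a unit. Applied to [qc] and [qd], this shows that the fibre has no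
    point at infinity. *)
Lemma kap_pow (l : k) q : l != 0 -> tau_hom_mac S q ->
  exists n, ideal2 (kap F.[c4 l]) (kap G.[c4 l]) (kap q ^+ n).
Proof.
move=> l0 [mq /(_ sx sy)[e hq]]; have [N [n [a [b E]]]] := rees_pow mq hq; exists n.
rewrite -rmorphXn; apply: ideal2_map; exists (a.[c4 l] / c4 l ^+ N), (b.[c4 l] / c4 l ^+ N).
have lU : (c4 l ^+ N : R) \is a GRing.unit.
  by rewrite unitrX // rmorph_unit // unitfE.
apply: (mulrI lU); have := congr1 (fun P : {poly R} => P.[c4 l]) E.
rewrite hornerM hornerXn hornerC hornerD !hornerM => ->; rewrite mulrDr.
by congr (_ + _); rewrite mulrA mulrCA mulrV // mulr1.
Qed.

Let kap_qc : kap (@qc k R) = - x2 ^+ 3.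
Proof. by rewrite /qc rmorphB rmorphM !rmorphXn /= /kap evw evx evy expr0n mul0r sub0r. Qed.
Let kap_qd : kap (@qd k R) = y2 ^+ 3.
Proof. by rewrite /qd rmorphB rmorphXn rmorphM rmorphXn /= /kap evx evy evz expr0n mulr0 subr0. Qed.

Let kap_xy (u v : S) :
  (exists n, ideal2 u v (kap (@qc k R) ^+ n)) -> (exists n, ideal2 u v (kap (@qd k R) ^+ n)) ->
  exists N M, ideal2 u v (x2 ^+ N) /\ ideal2 u v (y2 ^+ M).
Proof.
rewrite kap_qc kap_qd => -[n Ix] [m Iy]; exists (3 * n)%N, (3 * m)%N; rewrite !exprM; split=> //.
have -> : (x2 ^+ 3) ^+ n = (-1) ^+ n * (- x2 ^+ 3) ^+ n :> S by rewrite -exprMn mulN1r opprK.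
exact: ideal2M.
Qed.

(** Otherwise [kap v] alone would divide powers of x and of y, hence be a unit, although it is a
    form of positive degree. *)
Lemma kap_neq0 (u v : R) d N M : (0 < d)%N -> homog tot d v ->
  ideal2 (kap u) (kap v) (x2 ^+ N) -> ideal2 (kap u) (kap v) (y2 ^+ M) -> kap u != 0.
Proof.
move=> d0 hv Ix Iy; apply/eqP => u0; rewrite u0 in Ix Iy.
have dv w : ideal2 0 (kap v) w -> divides (kap v) w.
  by case=> a [b ->]; exists b; rewrite mulr0 add0r.
have vU := divides_xy_unit (dv _ Ix) (dv _ Iy).
have [_ vE] := dehom_top S hv.
have vh : homog (@coact2 k S 1 1) d (kap v) by rewrite -vE; apply: coact2K.
have v0 : kap v != 0 by apply: contraTneq vU => ->; rewrite unitr0.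
have w0 : (kap v)^-1 != 0 by rewrite invr_eq0.
have := deg2M v0 w0; rewrite mulrV // {1}/deg2 {1}/gdeg rmorph1 size_poly1.
by rewrite (homog_gdeg v0 vh : deg2 (kap v) = d); lia.
Qed.

Lemma limit_unit : h \is a GRing.unit.
Proof.
have [n1 S1] := satI_q (qa_hom R S); have [n2 S2] := satI_q (qb_hom R S).
rewrite dehom_qa in S1; rewrite dehom_qb in S2.
have [N0 fin0] := span_finite S n1 n2.
have [f2 [g2 [[f20 g20 rp2 Jf Jg] [df dg]]]] := coprime_in_J.
(* Serves both the finiteness over k[T], which needs at least [N0], and [bezout_upper], which needs
   at least the sum of the degrees. *)
pose N := (N0 + (deg2 f2 + deg2 g2))%N.
have [r [e [rle span]]] := @bezout_upper k S f2 g2 f20 g20 N rp2 (leq_addl _ _).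
have [|s ds|l l0 spanl] := @span_specialize k S F1 G1 _ _ N S1 S2 _ r e.
- move=> s; have [s' [ds' I]] := fin0 s; exists s'; split=> //.
  by apply: leq_trans ds' _; rewrite leq_addr.
- have [c [u [v sE]]] := span s ds; exists c.
  have -> : s - \sum_i c2 (c i) * e i = u * f2 + v * g2 by rewrite {1}sE; ring.
  by apply: initID; apply: initIM.
have hFl := Fl_homog l Fhom; have hGl := Fl_homog l Ghom.
have [A [M [Ix Iy]]] := kap_xy (kap_pow l0 (qc_hom R S)) (kap_pow l0 (qd_hom R S)).
have kF0 := kap_neq0 d2_gt0 hGl Ix Iy.
have kG0 := kap_neq0 d1_gt0 hFl (ideal2C Ix) (ideal2C Iy).
have [dF tF] := dehom_top S hFl; have [dG tG] := dehom_top S hGl.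
have [F0 dFE lF] := top_form kF0 dF tF; have [G0 dGE lG] := top_form kG0 dG tG.
have le : (d1 * d2 <= r)%N.
  rewrite -dFE -dGE; apply: (@bezout_tops k S _ _ A M r e F0 G0); rewrite ?lF ?lG //.
  by move=> P; have := spanl P; rewrite !horner_map_dehom.
have hd : gdeg tot h = 0%N.
  have e1 : (gdeg tot h + gdeg tot f' = d1)%N.
    rewrite -(gdegM (@tot1 k R)) //; apply: homog_gdeg => //; rewrite -f0E; exact: Fhom.
  have e2 : (gdeg tot h + gdeg tot g' = d2)%N.
    rewrite -(gdegM (@tot1 k R)) //; apply: homog_gdeg => //; rewrite -g0E; exact: Ghom.
  have l1 := leq_trans df (deg2_dehom S f'); have l2 := leq_trans dg (deg2_dehom S g').
  have := leq_trans le (leq_trans rle (leq_mul l1 l2)).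
  move: e1 e2 d1_gt0 d2_gt0; nia.
have [c hE] := gdeg0_const hd; rewrite hE rmorph_unit // unitfE.
by apply: contraNneq h0 => c0; rewrite hE c0 rmorph0.
Qed.

Lemma limit_contradiction : False.
Proof.
have hU := limit_unit.
have If q : tau_hom_mac S q -> exists n, ideal2 (h * f') (h * g') (q ^+ n).
  case=> mq /(_ sx sy)[e hq]; have [N [n I]] := limit_pow mq hq; exists n.
  apply: (ideal2_unit (u := h ^+ N)); first by rewrite unitrX.
  apply: ideal2_sub I; apply: (ideal2_unit hU); [exact: ideal2_l|exact: ideal2_r].
have hf : homog tot d1 (h * f') by rewrite -f0E; apply: Fhom.
have hg : homog tot d2 (h * g') by rewrite -g0E; apply: Ghom.
have kapI q : tau_hom_mac S q -> exists n, ideal2 (kap (h * f')) (kap (h * g')) (kap q ^+ n).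
  by move=> /If[n I]; exists n; rewrite -rmorphXn; apply: ideal2_map.
have [A [M [Ix Iy]]] := kap_xy (kapI _ (qc_hom R S)) (kapI _ (qd_hom R S)).
have [n In] := If _ (qe_hom R S).
have dx : cf4 (h * f') 0 d1 0 0 != 0 \/ cf4 (h * g') 0 d2 0 0 != 0.
  by apply: (pure_term_x (S := S)) => //; exists A.
have dy : cf4 (h * f') 0 0 d1 0 != 0 \/ cf4 (h * g') 0 0 d2 0 != 0.
  by apply: (pure_term_y (S := S)) => //; exists M.
(* x^d and y^d have different bidegrees, so the two pure powers must come from different initial
   forms. *)
have excl i j (H : R) d : (0 < d)%N -> bihom i j H -> cf4 H 0 d 0 0 != 0 -> cf4 H 0 0 d 0 != 0 -> False.
  move=> d0 /bihomP hH /hH[e1 _] /hH[e2 _]; move: e1 e2; rewrite /bideg1; lia.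
case: dx dy => [fx|gx] [fy|gy].
- exact: (excl _ _ _ _ d1_gt0 f0_bihom fx fy).
- exact: (bihom_case S hchar d1_gt0 d2_gt0 hf hg f0_bihom g0_bihom fx gy In).
- exact: (bihom_case S hchar d2_gt0 d1_gt0 hg hf g0_bihom f0_bihom gx fy (ideal2C In)).
- exact: (excl _ _ _ _ d2_gt0 g0_bihom gx gy).
Qed.
End Degeneration.

Lemma prime_ideal_factor (A : idomainType) (P : A -> Prop) a s :
  prime_ideal P -> factors_as a s -> P a -> exists2 p, p \in s & P p.
Proof.
move=> [_ _ PM P1 PP] [_ [u uU ->]] /PP[Pu|].
  by case: P1; rewrite -(mulVr uU); apply: PM.
elim: s => [|p s IH]; first by rewrite big_nil.
rewrite big_cons => /PP[Pp|/IH[q qs Pq]]; first by exists p; rewrite ?mem_head.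
by exists q; rewrite // inE qs orbT.
Qed.

(** * Minimal primes of the pair of initial forms *)

Section Limit.
Variables (k : closedFieldType) (R : poly4 k) (S : poly2 k).
Hypothesis hchar : [pchar k] =i pred0.
Local Notation tot := (@tot k R).
Local Notation in_mac := (@in_mac k R S).

(** Nonzero constants are units, so a prime element has positive total degree, and its powers
    eventually exceed the degree of [a]. *)
Lemma prime_power_bound (p a : R) : prime_elt p -> a != 0 -> exists n, ~ divides (p ^+ n) a.
Proof.
move=> [p0 pU _] a0; exists (gdeg tot a).+1 => -[q aE].
have q0 : q != 0 by apply: contraNneq a0 => h; rewrite aE h mul0r.
have dp : gdeg tot p != 0%N.
  apply: contraNneq pU => /gdeg0_const[e pE]; rewrite pE rmorph_unit // unitfE.
  by apply: contraNneq p0 => e0; rewrite pE e0 rmorph0.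
have := gdegM (@tot1 k R) q0 (expf_neq0 (gdeg tot a).+1 p0).
by rewrite -aE (gdegX (@tot1 k R)) // ; nia.
Qed.

Lemma coact_shift sx sy (f : R) i0 d :
  homog tot d f -> (forall n, (n < i0)%N -> (tau R sx sy f)`_n = 0) ->
  exists F, [/\ tau R sx sy f = 'X^i0 * F, F`_0 = (tau R sx sy f)`_i0 &
                forall n, homog tot d F`_n].
Proof.
move=> /tot_homogP hf low; exists (drop_poly i0 (tau R sx sy f)); split.
- rewrite -{1}[tau R sx sy f](poly_take_drop i0) mulrC.
  suff -> : take_poly i0 (tau R sx sy f) = 0 by rewrite add0r.
  by apply/polyP => n; rewrite coef_take_poly coef0; case: ltnP => // /low.
- by rewrite coef_drop_poly add0n.
move=> n; rewrite coef_drop_poly; apply/tot_homogP => a b c e.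
by rewrite /tau cf4_coact; case: ifP => [_ /hf|]; rewrite ?eqxx.
Qed.

Variables (f g : R) (d1 d2 sx sy i0 j0 i1 j1 i2 j2 : nat).
Hypothesis mf : in_mac f.
Hypothesis mg : in_mac g.
Hypothesis hf : homog tot d1 f.
Hypothesis hg : homog tot d2 g.
Hypothesis hrad : forall q, in_mac q -> exists n, ideal2 f g (q ^+ n).
Hypothesis f_low : forall n, (n < i0)%N -> (tau R sx sy f)`_n = 0.
Hypothesis g_low : forall n, (n < j0)%N -> (tau R sx sy g)`_n = 0.
Local Notation f0 := (tau R sx sy f)`_i0.
Local Notation g0 := (tau R sx sy g)`_j0.
Hypothesis f0_neq0 : f0 != 0.
Hypothesis g0_neq0 : g0 != 0.
Hypothesis f0_bihom : bihom i1 j1 f0.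
Hypothesis g0_bihom : bihom i2 j2 g0.

Lemma gcd_in_mac h f' g' : f0 = h * f' -> g0 = h * g' -> rel_prime f' g' -> in_mac h.
Proof.
move=> fE gE rp; apply: NNPP => nh.
have [F [tF F0 hF]] := coact_shift hf f_low; have [G [tG G0 hG]] := coact_shift hg g_low.
have fn := f0_neq0; have gn := g0_neq0; have fb := f0_bihom; have gb := g0_bihom.
rewrite fE in F0 fn fb; rewrite gE in G0 gn gb.
exact: (limit_contradiction hchar hrad tF tG F0 G0 fn gn rp mf mg hF hG fb gb nh).
Qed.

Lemma limit_minimal_prime P : minimal_prime_over (ideal2 f0 g0) P -> height_eq P 1.
Proof.
move=> [Pp subP minP].
have [h [f' [g' [fE gE rp]]]] := rel_prime_gcd (@ufd4 k R) f0_neq0 g0_neq0.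
have [P0 PD PM P1 PP] := Pp.
have Ph : P h.
  apply: NNPP => nPh.
  have Pf : P f' by have : P f0 by [apply/subP/ideal2_l]; rewrite fE => /PP[].
  have Pg : P g' by have : P g0 by [apply/subP/ideal2_r]; rewrite gE => /PP[].
  have [F [tF F0 hF]] := coact_shift hf f_low; have [G [tG G0 hG]] := coact_shift hg g_low.
  have mh := gcd_in_mac fE gE rp.
  have fn := f0_neq0; have gn := g0_neq0.
  rewrite fE in F0 fn; rewrite gE in G0 gn.
  apply: (nPh); exact: (prime_over_limit hrad tF tG F0 G0 fn gn rp Pp Pf Pg nPh mh).
have h0 : h != 0 by apply: contraNneq f0_neq0 => h0; rewrite fE h0 mul0r.
have [s hs] := ufd4 h0; have [p ps Ppp] := prime_ideal_factor Pp hs Ph.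
have pp : prime_elt p by case: hs => + _; apply.
have ph : divides p h.
  case: hs => _ [u _ ->]; apply: divides_mull; rewrite (big_rem p) //=.
  by apply: divides_mulr; exists 1; rewrite mul1r.
have sub1 : subI (divides p) P by move=> a [q ->]; apply: PM.
apply: (principal_height1 pp) => //; first by move=> a; apply: prime_power_bound.
(* The principal prime (p) already contains both initial forms, so minimality makes it equal to
   [P]. *)
have sub2 : subI P (divides p).
  apply: minP => //; first exact: principal_prime_ideal.
  move=> a [u [v ->]]; rewrite fE gE; apply: dividesD; apply: divides_mull; exact: divides_mulr.
by move=> a; split; [apply: sub2|apply: sub1].
Qed.

Lemma limit_common_divisor :
  exists h, ~ (h \is a GRing.unit) /\ divides h f0 /\ divides h g0.
Proof.
have [h [f' [g' [fE gE rp]]]] := rel_prime_gcd (@ufd4 k R) f0_neq0 g0_neq0.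
exists h; split; last by split; [exists f'; rewrite fE mulrC|exists g'; rewrite gE mulrC].
move=> hU; have [_ _ PM P1 _] := in_mac_prime R S.
by apply: P1; rewrite -(mulVr hU); apply: PM; apply: gcd_in_mac fE gE rp.
Qed.
End Limit.

(** * Bihomogeneous components *)

Section Bicomp.
Variable k : closedFieldType.
Implicit Types F G : R4 k.

Lemma coef4_bicomp i j F a b c d : coef4 (bicomp i j F) a b c d =
  if (bideg1 a b c d == i) && (bideg2 a b c d == j) then coef4 F a b c d else 0.
Proof.
rewrite /coef4 /bicomp coef_poly; case: ltnP => hd; last first.
  by rewrite !coef0 [F`_d]nth_default // !coef0 if_same.
rewrite coef_poly; case: ltnP => hc; last first.
  by rewrite !coef0 [F`_d`_c]nth_default // !coef0 if_same.
rewrite coef_poly; case: ltnP => hb; last first.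
  by rewrite !coef0 [F`_d`_c`_b]nth_default // !coef0 if_same.
rewrite coef_poly; case: ltnP => ha //.
by rewrite [F`_d`_c`_b`_a]nth_default // if_same.
Qed.

Lemma coef4_inj F G : (forall a b c d, coef4 F a b c d = coef4 G a b c d) -> F = G.
Proof.
by move=> h; apply/polyP => d; apply/polyP => c; apply/polyP => b; apply/polyP => a; apply: h.
Qed.

Lemma homogeneous_bideg n F a b c d : homogeneous n F -> coef4 F a b c d != 0 ->
  (bideg1 a b c d + bideg2 a b c d = 4 * n)%N.
Proof. by move=> hF /hF <-; rewrite /bideg1 /bideg2; lia. Qed.

Local Notation R := (nested_poly4 k).

Lemma bicomp_tau1 n F i : homogeneous n F ->
  bicomp i (4 * n - i) F = (tau R 1 0 F)`_i.
Proof.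
move=> hF; apply: coef4_inj => a b c d; rewrite coef4_bicomp.
rewrite -[coef4 (_`_i) a b c d]/(cf4 (p := R) _ a b c d) /tau cf4_coact /=.
have -> : wt (4 * 1) (3 * 1 + 0) (1 + 3 * 0) (4 * 0) a b c d = bideg1 a b c d.
  by rewrite /wt /bideg1; lia.
rewrite -[X in _ = if _ then X else _]/(coef4 F a b c d).
have [h|/(homogeneous_bideg hF) E] := eqVneq (coef4 F a b c d) 0.
  by rewrite h; do 2 case: ifP.
case: eqP => //= e1; suff -> : bideg2 a b c d == (4 * n - i)%N by [].
by apply/eqP; lia.
Qed.

(** For [i > 4 * n] the truncated difference is 0, and the right side could be a nonzero component
    of second degree 0. *)
Lemma bicomp_tau2 n F i : homogeneous n F -> (i <= 4 * n)%N ->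
  bicomp i (4 * n - i) F = (tau R 0 1 F)`_(4 * n - i).
Proof.
move=> hF le; apply: coef4_inj => a b c d; rewrite coef4_bicomp.
rewrite -[coef4 (_`_(4 * n - i)) a b c d]/(cf4 (p := R) _ a b c d) /tau cf4_coact /=.
have -> : wt (4 * 0) (3 * 0 + 1) (0 + 3 * 1) (4 * 1) a b c d = bideg2 a b c d.
  by rewrite /wt /bideg2; lia.
rewrite -[X in _ = if _ then X else _]/(coef4 F a b c d).
have [h|/(homogeneous_bideg hF) E] := eqVneq (coef4 F a b c d) 0.
  by rewrite h; do 2 case: ifP.
rewrite andbC; case: eqP => //= e1; suff -> : bideg1 a b c d == i by [].
by apply/eqP; lia.
Qed.

Lemma bihom_bicomp i j F : bihom (R := R) i j (bicomp i j F).
Proof.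
apply/bihomP => a b c d; rewrite -[cf4 _ a b c d]/(coef4 _ a b c d) coef4_bicomp.
by case: andP => [[/eqP-> /eqP->]|]; rewrite ?eqxx.
Qed.

Lemma bicomp_neq0_le n F i : homogeneous n F -> bicomp i (4 * n - i) F != 0 -> (i <= 4 * n)%N.
Proof.
move=> hF /(@cf4_neq0 k R)[a [b [c [d]]]]; rewrite -[cf4 _ a b c d]/(coef4 _ a b c d) coef4_bicomp.
case: andP => [[/eqP e1 _]|]; rewrite ?eqxx // => /(homogeneous_bideg hF); lia.
Qed.
End Bicomp.

Theorem theorem1 (k : closedFieldType) (hchar : [pchar k] =i pred0)
  (f g : R4 k) (d1 d2 : nat)
  (hfp : macaulay_ideal f) (hgp : macaulay_ideal g)
  (hfh : homogeneous d1 f) (hgh : homogeneous d2 g)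
  (hrad : eqI (radical (ideal2 f g)) (@macaulay_ideal k))
  (imin imax jmin jmax : nat)
  (hfmin : bicomp imin (4 * d1 - imin) f != 0)
  (hfmin' : forall i, (i < imin)%N -> bicomp i (4 * d1 - i) f = 0)
  (hfmax : bicomp imax (4 * d1 - imax) f != 0)
  (hfmax' : forall i, (imax < i)%N -> bicomp i (4 * d1 - i) f = 0)
  (hgmin : bicomp jmin (4 * d2 - jmin) g != 0)
  (hgmin' : forall j, (j < jmin)%N -> bicomp j (4 * d2 - j) g = 0)
  (hgmax : bicomp jmax (4 * d2 - jmax) g != 0)
  (hgmax' : forall j, (jmax < j)%N -> bicomp j (4 * d2 - j) g = 0) :
  let fmin := bicomp imin (4 * d1 - imin) f in
  let fmax := bicomp imax (4 * d1 - imax) f in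
  let gmin := bicomp jmin (4 * d2 - jmin) g in
  let gmax := bicomp jmax (4 * d2 - jmax) g in
  [/\ (forall P, minimal_prime_over (ideal2 fmin gmin) P -> height_eq P 1),
      (forall P, minimal_prime_over (ideal2 fmax gmax) P -> height_eq P 1),
      (exists h, ~ (h \is a GRing.unit) /\ divides h fmin /\ divides h gmin) &
      (exists h, ~ (h \is a GRing.unit) /\ divides h fmax /\ divides h gmax)].
Proof.
move=> fmin fmax gmin gmax.
pose R := nested_poly4 k; pose S := nested_poly2 k.
have mf : @in_mac k R S f by apply/macaulay_ideal_ev.
have mg : @in_mac k R S g by apply/macaulay_ideal_ev.
have tf : homog (@tot k R) d1 f by apply/tot_homogP => a b c d; apply: hfh.
have tg : homog (@tot k R) d2 g by apply/tot_homogP => a b c d; apply: hgh.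
have rad (q : R) : @in_mac k R S q -> exists n, ideal2 f g (q ^+ n).
  by move=> /macaulay_ideal_ev /hrad.
have lef := bicomp_neq0_le hfh hfmax; have leg := bicomp_neq0_le hgh hgmax.
have fminE : fmin = (tau R 1 0 f)`_imin := bicomp_tau1 _ hfh.
have gminE : gmin = (tau R 1 0 g)`_jmin := bicomp_tau1 _ hgh.
have fmaxE : fmax = (tau R 0 1 f)`_(4 * d1 - imax) := bicomp_tau2 hfh lef.
have gmaxE : gmax = (tau R 0 1 g)`_(4 * d2 - jmax) := bicomp_tau2 hgh leg.
have fminL n : (n < imin)%N -> (tau R 1 0 f)`_n = 0.
  by move=> lt; rewrite -(bicomp_tau1 _ hfh); apply: hfmin'.
have gminL n : (n < jmin)%N -> (tau R 1 0 g)`_n = 0.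
  by move=> lt; rewrite -(bicomp_tau1 _ hgh); apply: hgmin'.
(* Second degree [n] below [4 * d1 - imax] means first degree [4 * d1 - n] above [imax]. *)
have fmaxL n : (n < 4 * d1 - imax)%N -> (tau R 0 1 f)`_n = 0.
  move=> lt; have -> : n = (4 * d1 - (4 * d1 - n))%N by lia.
  by rewrite -(bicomp_tau2 hfh) ?leq_subr //; apply: hfmax'; lia.
have gmaxL n : (n < 4 * d2 - jmax)%N -> (tau R 0 1 g)`_n = 0.
  move=> lt; have -> : n = (4 * d2 - (4 * d2 - n))%N by lia.
  by rewrite -(bicomp_tau2 hgh) ?leq_subr //; apply: hgmax'; lia.
have bfmin : bihom (R := R) imin (4 * d1 - imin) fmin := bihom_bicomp _ _ _.
have bgmin : bihom (R := R) jmin (4 * d2 - jmin) gmin := bihom_bicomp _ _ _.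
have bfmax : bihom (R := R) imax (4 * d1 - imax) fmax := bihom_bicomp _ _ _.
have bgmax : bihom (R := R) jmax (4 * d2 - jmax) gmax := bihom_bicomp _ _ _.
have nfmin : fmin != 0 := hfmin. have ngmin : gmin != 0 := hgmin.
have nfmax : fmax != 0 := hfmax. have ngmax : gmax != 0 := hgmax.
rewrite fminE in nfmin bfmin *; rewrite gminE in ngmin bgmin *.
rewrite fmaxE in nfmax bfmax *; rewrite gmaxE in ngmax bgmax *.
split.
- exact: (limit_minimal_prime hchar mf mg tf tg rad fminL gminL nfmin ngmin bfmin bgmin).
- exact: (limit_minimal_prime hchar mf mg tf tg rad fmaxL gmaxL nfmax ngmax bfmax bgmax).
- exact: (limit_common_divisor hchar mf mg tf tg rad fminL gminL nfmin ngmin bfmin bgmin).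
- exact: (limit_common_divisor hchar mf mg tf tg rad fmaxL gmaxL nfmax ngmax bfmax bgmax).
Qed.
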